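(* There exist an $L^1$-space $E$ (with complex scalars) over a $\sigma$-finite measure space and an irreducible and stochastic $C_0$-semigroup on $E$ such that the spectrum $\sigma(A)$ of its generator $A$ satisfies $$\sigma(A) \cap i\mathbb{R} = i(-\infty,-1] \;\cup\; \{0\} \;\cup\; i[1,\infty).$$
   Context: A $C_0$-semigroup $(T(t))_{t \in [0,\infty)}$ on an $L^1$-space $E$ is called stochastic if each operator $T(t)$ is stochastic, i.e. for each $0 \le f \in E$ and each $t \ge 0$ we have $T(t)f \ge 0$ and $\|T(t)f\| = \|f\|$. A positive $C_0$-semigroup on a Banach lattice $E$ is called irreducible if there is no closed (lattice) ideal of $E$, other than $\{0\}$ and $E$, that is invariant under all operators $T(t)$, $t \ge 0$. *)

(* Defs.v *)
From HB Require Import structures.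
From mathcomp Require Import all_boot all_order all_algebra.
From mathcomp Require Import generic_quotient ring_quotient.
From mathcomp Require Import complex.
From mathcomp Require Import all_classical all_reals all_analysis.
From mathcomp Require Import measurable_realfun lebesgue_measure.

Set Implicit Arguments.
Unset Strict Implicit.
Unset Printing Implicit Defensive.

Import Order.TTheory GRing.Theory Num.Theory.
Import numFieldNormedType.Exports.
Import ComplexField.Normc.

Local Open Scope classical_set_scope.
Local Open Scope ring_scope.
Local Open Scope quotient_scope.
Local Open Scope complex_scope.

Section CFun.
Context (R : realType) (d : measure_display) (X : measurableType d)
  (mu : {measure set X -> \bar R}).

Definition cmeasurable (f : X -> R[i]) : Prop :=
  measurable_fun setT (fun x => complex.Re (f x)) /\
  measurable_fun setT (fun x => complex.Im (f x)).

Definition cintegrable (f : X -> R[i]) : Prop :=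
  cmeasurable f /\ (\int[mu]_x (normc (f x))%:E < +oo)%E.

Lemma normcE (z : R[i]) : (normc z)%:C = `|z|.
Proof. by []. Qed.

Lemma normc_ge0 (z : R[i]) : 0 <= normc z.
Proof. by case: z => a b; exact: sqrtr_ge0. Qed.

Lemma ler_normcD (z w : R[i]) : normc (z + w) <= normc z + normc w.
Proof. by have := ler_normD z w; rewrite -!normcE -rmorphD lecR. Qed.

Lemma measurable_normc (f : X -> R[i]) : cmeasurable f ->
  measurable_fun setT (fun x => (normc (f x))%:E).
Proof.
move=> [mr mi]; apply/measurable_EFinP => /=.
rewrite (_ : (fun x => _) =
  (fun x => (complex.Re (f x) ^+ 2 + complex.Im (f x) ^+ 2) `^ 2^-1)); last first.
  apply/funext => x; case: (f x) => a b /=.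
  by rewrite powR12_sqrt// addr_ge0// sqr_ge0.
apply: (measurableT_comp (measurable_powR _)).
by apply: measurable_funD; exact: measurable_funX.
Qed.

Lemma cmeasurableZD (a : R[i]) (f g : X -> R[i]) :
  cmeasurable f -> cmeasurable g -> cmeasurable (a *: f + g).
Proof.
case: a => a b [fr fi] [gr gi]; split.
  rewrite (_ : (fun x => _) = (fun x => (a * complex.Re (f x)
    - b * complex.Im (f x)) + complex.Re (g x))); last first.
    by apply/funext => x; rewrite /GRing.add/= /GRing.scale/=; case: (f x) (g x) => ? ? [].
  apply: measurable_funD => //; apply: measurable_funB;
  exact: measurable_funM.
rewrite (_ : (fun x => _) = (fun x => (a * complex.Im (f x)
    + b * complex.Re (f x)) + complex.Im (g x))); last first.
  by apply/funext => x; rewrite /GRing.add/= /GRing.scale/=; case: (f x) (g x) => ? ? [].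
apply: measurable_funD => //; apply: measurable_funD;
exact: measurable_funM.
Qed.

Lemma cmeasurable0 : cmeasurable 0.
Proof. by split; exact: measurable_cst. Qed.

Definition cintegrable_pred : {pred X -> R[i]} := [pred f | `[< cintegrable f >]].

Lemma cintegrable_submod_closed : submod_closed cintegrable_pred.
Proof.
split=> [|a f g].
  apply/asboolP; split; first exact: cmeasurable0.
  by rewrite integral0_eq// => x _; rewrite normc0.
move=> /asboolP[mf If] /asboolP[mg Ig]; apply/asboolP; split.
  exact: cmeasurableZD.
apply: (@le_lt_trans _ _
  ((normc a)%:E * \int[mu]_x (normc (f x))%:E + \int[mu]_x (normc (g x))%:E)%E).
  rewrite -ge0_integralZl//=; last 3 first.
  - exact: measurable_normc.
  - by move=> x _; rewrite lee_fin normc_ge0.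
  - by rewrite lee_fin normc_ge0.
  rewrite -ge0_integralD//=; last 4 first.
  - by move=> x _; rewrite -EFinM lee_fin mulr_ge0// normc_ge0.
  - by apply: measurable_funeM; exact: measurable_normc.
  - by move=> x _; rewrite lee_fin normc_ge0.
  - exact: measurable_normc.
  apply: ge0_le_integral => //=.
  - by move=> x _; rewrite lee_fin normc_ge0.
  - by apply: measurable_normc; exact: cmeasurableZD.
  - apply: emeasurable_funD; last exact: measurable_normc.
    by apply: measurable_funeM; exact: measurable_normc.
  - move=> x _; rewrite -EFinM -EFinD lee_fin -normcM; exact: ler_normcD.
by rewrite lte_add_pinfty// lte_mul_pinfty// lee_fin normc_ge0.
Qed.

HB.instance Definition _ := GRing.isSubmodClosed.Build R[i] (X -> R[i])
  cintegrable_pred cintegrable_submod_closed.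

Record cIntFun := CIntFun {
  cintfun_val :> X -> R[i];
  cintfunP : cintfun_val \in cintegrable_pred }.

HB.instance Definition _ := [isSub for cintfun_val].
HB.instance Definition _ := [Choice of cIntFun by <:].
HB.instance Definition _ := [SubChoice_isSubLmodule of cIntFun by <:].

Definition cnull : {pred cIntFun} :=
  [pred f : cIntFun | `[< {ae mu, forall x, f x = 0} >]].

Lemma cnull_submod_closed : submod_closed cnull.
Proof.
split=> [|a f g]; first by apply/asboolP; exact: aeW.
move=> /asboolP f0 /asboolP g0; apply/asboolP.
apply: filterS2 f0 g0 => x /= fx gx.
transitivity (a * f x + g x : R[i]); first by [].
by rewrite fx gx mulr0 addr0.
Qed.

HB.instance Definition _ := GRing.isSubmodClosed.Build R[i] cIntFun
  cnull cnull_submod_closed.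

Definition cL1 : Type := Quotient.quot cnull.
HB.instance Definition _ := GRing.Zmodule.on cL1.

Definition cL1_pi (f : cIntFun) : cL1 := \pi_(Quotient.quot cnull) f.
Definition cL1_repr (f : cL1) : cIntFun := repr (f : Quotient.quot cnull).

Lemma cL1_reprK (f : cL1) : cL1_pi (cL1_repr f) = f.
Proof. exact: reprK. Qed.

Lemma cL1_piD f g : cL1_pi (f + g) = cL1_pi f + cL1_pi g.
Proof. exact: Quotient.pi_add. Qed.

Lemma cL1_pi0 : cL1_pi 0 = 0.
Proof. by apply: (addIr (cL1_pi 0)); rewrite -cL1_piD !add0r. Qed.

Lemma cL1_pi_eqP f g : cL1_pi f = cL1_pi g <-> {ae mu, forall x, f x = g x}.
Proof.
transitivity (f - g \in cnull).
  rewrite Quotient.idealrBE; split => [fg|/eqP//]; exact/eqP.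
split=> [/asboolP|] fg.
  by apply: (filterS _ fg) => x /= /eqP; rewrite subr_eq0 => /eqP.
apply/asboolP; apply: (filterS _ fg) => x /= fgx.
transitivity (f x - g x : R[i]); first by [].
by rewrite fgx subrr.
Qed.

Lemma cL1_repr_pi f : {ae mu, forall x, cL1_repr (cL1_pi f) x = f x}.
Proof. by apply/cL1_pi_eqP; rewrite cL1_reprK. Qed.

Definition cL1_scale (a : R[i]) (f : cL1) : cL1 := cL1_pi (a *: cL1_repr f).

Lemma cL1_scale_pi a f : cL1_scale a (cL1_pi f) = cL1_pi (a *: f).
Proof.
apply/cL1_pi_eqP; apply: (filterS _ (cL1_repr_pi f)) => x /= fx.
transitivity (a * cL1_repr (cL1_pi f) x : R[i]); first by [].
by rewrite fx.
Qed.

Let scaleA a b f : cL1_scale a (cL1_scale b f) = cL1_scale (a * b) f.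
Proof. by rewrite -[f]cL1_reprK !cL1_scale_pi scalerA. Qed.

Let scale1 : left_id 1 cL1_scale.
Proof. by move=> f; rewrite -[f]cL1_reprK !cL1_scale_pi scale1r. Qed.

Let scaleDr : right_distributive cL1_scale +%R.
Proof.
move=> a f g; rewrite -[f]cL1_reprK -[g]cL1_reprK.
by rewrite -cL1_piD !cL1_scale_pi scalerDr cL1_piD.
Qed.

Let scaleDl f : {morph cL1_scale^~ f : a b / a + b}.
Proof. by move=> a b; rewrite -[f]cL1_reprK !cL1_scale_pi scalerDl cL1_piD. Qed.

HB.instance Definition _ := GRing.Zmodule_isLmodule.Build R[i] cL1
  scaleA scale1 scaleDr scaleDl.

Definition cintnorm (f : X -> R[i]) : R := fine (\int[mu]_x (normc (f x))%:E)%E.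

(* As cL1 is a normed module over R[i], its norm has to take values in R[i];
   it is the image of a nonnegative element of R. *)
Definition cL1_norm (f : cL1) : R[i] := (cintnorm (cL1_repr f))%:C.

Lemma cIntFun_measurable (f : cIntFun) : cmeasurable f.
Proof. by case: f => f /= /asboolP[]. Qed.

Lemma cIntFun_normE (f : cIntFun) :
  (\int[mu]_x (normc (f x))%:E)%E = (cintnorm f)%:E.
Proof.
rewrite fineK// ge0_fin_numE; first by case: f => f /= /asboolP[].
by apply: integral_ge0 => x _; rewrite lee_fin normc_ge0.
Qed.

Lemma cL1_norm_pi f : cL1_norm (cL1_pi f) = (cintnorm f)%:C.
Proof.
rewrite /cL1_norm /cintnorm; congr ((fine _)%:C).
apply: ge0_ae_eq_integral => //.
- exact/measurable_normc/cIntFun_measurable.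
- exact/measurable_normc/cIntFun_measurable.
- by move=> x _; rewrite lee_fin normc_ge0.
- by move=> x _; rewrite lee_fin normc_ge0.
- by apply: (filterS _ (cL1_repr_pi f)) => x /= ->.
Qed.

Let norm_triangle f g : cL1_norm (f + g) <= cL1_norm f + cL1_norm g.
Proof.
rewrite -[f]cL1_reprK -[g]cL1_reprK -cL1_piD !cL1_norm_pi -rmorphD lecR.
rewrite -lee_fin EFinD -!cIntFun_normE -ge0_integralD//; last 4 first.
- by move=> x _; rewrite lee_fin normc_ge0.
- exact/measurable_normc/cIntFun_measurable.
- by move=> x _; rewrite lee_fin normc_ge0.
- exact/measurable_normc/cIntFun_measurable.
apply: ge0_le_integral => //.
- by move=> x _; rewrite lee_fin normc_ge0.
- exact/measurable_normc/cIntFun_measurable.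
- apply: emeasurable_funD; exact/measurable_normc/cIntFun_measurable.
- by move=> x _; rewrite -EFinD lee_fin; exact: ler_normcD.
Qed.

Let norm_scale a f : cL1_norm (a *: f) = `|a| * cL1_norm f.
Proof.
rewrite -[f]cL1_reprK [a *: _]cL1_scale_pi !cL1_norm_pi -normcE -rmorphM.
congr (_%:C); apply: EFin_inj; rewrite EFinM -!cIntFun_normE.
rewrite -ge0_integralZl//; last 3 first.
- exact/measurable_normc/cIntFun_measurable.
- by move=> x _; rewrite lee_fin normc_ge0.
- by rewrite lee_fin normc_ge0.
by apply: eq_integral => x _; rewrite -EFinM -normcM.
Qed.

Let norm_eq0 f : cL1_norm f = 0 -> f = 0.
Proof.
rewrite -[f]cL1_reprK cL1_norm_pi; set g := cL1_repr f => -[g0].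
have : (\int[mu]_x `|(normc (g x))%:E| = 0)%E.
  rewrite -[RHS]/(0%:E) -g0 -cIntFun_normE; apply: eq_integral => x _.
  by rewrite gee0_abs// lee_fin normc_ge0.
move=> /ae_eq_integral_abs -/(_ measurableT)
  /(_ (measurable_normc (cIntFun_measurable g))) ge0.
rewrite -cL1_pi0; apply/cL1_pi_eqP; apply: (filterS _ ge0) => x /= /(_ Logic.I) [].
exact: eq0_normc.
Qed.

HB.instance Definition _ := Lmodule_isNormed.Build R[i] cL1
  norm_triangle norm_scale norm_eq0.

Lemma cL1_normE (f : cL1) : `|f| = (cintnorm (cL1_repr f))%:C.
Proof. by []. Qed.


Definition cL1_ge0 (f : cL1) : Prop := {ae mu, forall x, 0 <= cL1_repr f x}.

Definition cL1_le_abs (f g : cL1) : Prop :=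
  {ae mu, forall x, `|cL1_repr f x| <= `|cL1_repr g x|}.

Definition positive_semigroup (T : R -> cL1 -> cL1) : Prop :=
  forall t f, 0 <= t -> cL1_ge0 f -> cL1_ge0 (T t f).

Definition stochastic_semigroup (T : R -> cL1 -> cL1) : Prop :=
  forall t f, 0 <= t -> cL1_ge0 f -> cL1_ge0 (T t f) /\ `|T t f| = `|f|.

(* ideals of the complex Banach lattice cL1: solid complex-linear subspaces *)
Definition lattice_ideal (I : set cL1) : Prop :=
  [/\ I 0,
      forall (a : R[i]) f g, I f -> I g -> I (a *: f + g) &
      forall f g, I g -> cL1_le_abs f g -> I f].

Definition irreducible_semigroup (T : R -> cL1 -> cL1) : Prop :=
  positive_semigroup T /\
  forall I : set cL1, lattice_ideal I -> closed I ->
    (forall t f, 0 <= t -> I f -> I (T t f)) ->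
    I = [set 0] \/ I = setT.

End CFun.

(* Semigroups are indexed by R; only the operators T t with 0 <= t matter. *)
Section C0Semigroup.
Context (R : realType) (E : normedModType R[i]).

Definition C0_semigroup (T : R -> E -> E) : Prop :=
  [/\ forall t, 0 <= t -> linear (T t) /\ continuous (T t),
      forall f, T 0 f = f,
      forall s t f, 0 <= s -> 0 <= t -> T (s + t) f = T s (T t f) &
      forall f, {within `[0, +oo[, continuous (fun t => T t f)}].

Definition diff_quotient (T : R -> E -> E) (f : E) (h : R) : E :=
  (h^-1)%:C *: (T h f - f).

Definition generator_dom (T : R -> E -> E) : set E :=
  [set f | cvg (diff_quotient T f h @[h --> 0^'+])].

(* meaningful on generator_dom T only *)
Definition generator (T : R -> E -> E) (f : E) : E :=
  lim (diff_quotient T f h @[h --> 0^'+]).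

(* (D, A) stands for the possibly unbounded operator A with domain D; lambda
   is in the resolvent set when lambda - A : D -> E has a bounded inverse S *)
Definition resolvent_set (D : set E) (A : E -> E) : set R[i] :=
  [set lambda | exists S : E -> E,
    [/\ linear S, continuous S,
        forall g, D (S g) /\ lambda *: S g - A (S g) = g &
        forall f, D f -> S (lambda *: f - A f) = f]].

Definition spectrum (D : set E) (A : E -> E) : set R[i] :=
  ~` resolvent_set D A.

End C0Semigroup.

Definition imaginary_axis (R : realType) : set R[i] :=
  [set z | complex.Re z = 0].

(* Main.v *)
(** The state space is a disjoint union of cycles, the n-th one having m = n+1
states, with the counting measure. The mass on the n-th cycle moves one step
forward at rate r_n = m theta_n / (2 pi), where all tails of (theta_n) are dense
in [1, 2[; for large n this is nearly a rotation of period 2 pi / theta_n, whose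
eigenvalues accumulate at the points i k theta_n. Independently, for each N the
states of the first N+1 cycles are averaged at rate b_N - b_(N+1), where
b_N = 1/(N+1); this makes the semigroup irreducible, and as b_N tends to 0 it
does not move the approximate eigenvalues away from the imaginary axis.
Averaging commutes with rotating, which gives the semigroup and the resolvent of
its generator in closed form. Total mass is preserved, so 0 is in the spectrum.
If |s| >= 1, then |s| = k tau with k a positive integer and 1 <= tau < 2, and
the waves x |-> exp(-/+ 2 pi i k x / m) on cycles with theta_n close to tau are
approximate eigenvectors for i s. If 0 < |s| < 1, then i s stays away from all
the points i k theta_n, and the resolvents on the cycles, which are geometric
sums, are bounded uniformly in n. *)

Require Import Defs.
From HB Require Import structures.
From mathcomp Require Import all_boot all_order all_algebra.
From mathcomp Require Import complex.
From mathcomp Require Import all_classical all_reals all_analysis.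
From mathcomp Require Import measurable_realfun lebesgue_measure.
From mathcomp Require Import ring lra.

Set Implicit Arguments.
Unset Strict Implicit.
Unset Printing Implicit Defensive.

Import Order.TTheory GRing.Theory Num.Theory.
Import numFieldNormedType.Exports.
Import ComplexField.Normc.

Local Open Scope classical_set_scope.
Local Open Scope ring_scope.
Local Open Scope complex_scope.

(** * The complex modulus with real values *)

Section ComplexModulus.
Context {R : realType}.
Implicit Types z w : R[i].

(** Let [Q_N] average over the first N+1 cycles and fix everything outside them. These projections
    are nested: [Q_M Q_N] is the one of larger index. Summation by parts therefore turns the product
    of the exponentials of t (b_N - b_(N+1)) (Q_N - 1) into one series: on the n-th cycle, a
    multiple of the identity plus the averages of index n and above, weighted by increments of that
    multiple. Averages are constant on cycles, hence fixed by rotations, so the multiple may be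
    replaced by any element of the group algebra of the cycle. Semigroup and resolvent are then both
    given by kernels, and operator identities reduce to identities between kernels. The obstacle is
    that r_n grows like n: the kernel of the generator is unbounded and no estimate may use its
    size. What replaces it is control of kernels uniform in n together with entrywise convergence,
    from which dominated convergence yields strong limits. The value 1 enters through an angle: for
    the resolvent at i s, the geometric sum on the n-th cycle is governed by an angle at most 2 pi
    |s| in absolute value, which stays away from a full turn because |s| < 1. *)

Lemma normcC (a : R) : normc a%:C = `|a|.
Proof. by rewrite /= expr0n/= addr0 sqrtr_sqr. Qed.

Lemma normcX z n : normc (z ^+ n) = normc z ^+ n.
Proof.
elim: n => [|n IH]; first by rewrite !expr0 normc1.
by rewrite !exprS normcM IH.
Qed.

Lemma normc_sum I (r : seq I) (P : pred I) (F : I -> R[i]) :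
  normc (\sum_(i <- r | P i) F i) <= \sum_(i <- r | P i) normc (F i).
Proof.
elim/big_rec2 : _ => [|i x y _ h]; first by rewrite normc0.
by apply: (le_trans (ler_normcD _ _)); rewrite lerD2l.
Qed.

Lemma ge0_normc z : 0 <= z -> z = (normc z)%:C.
Proof. by move=> z0; rewrite Defs.normcE ger0_norm. Qed.

Lemma ler_Re_normc z : `|complex.Re z| <= normc z.
Proof. by case: z => a b /=; rewrite -sqrtr_sqr ler_wsqrtr// lerDl sqr_ge0. Qed.

Lemma ler_Im_normc z : `|complex.Im z| <= normc z.
Proof. by case: z => a b /=; rewrite -sqrtr_sqr ler_wsqrtr// lerDr sqr_ge0. Qed.

Lemma normc_le_Re_Im z : normc z <= `|complex.Re z| + `|complex.Im z|.
Proof.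
case: z => a b /=.
rewrite -[leRHS]ger0_norm ?addr_ge0// -sqrtr_sqr ler_wsqrtr//.
by rewrite sqrrD !real_normK ?num_real// lerD2r lerDl mulrn_wge0// mulr_ge0.
Qed.

Lemma normc_eq0 z : (normc z == 0) = (z == 0).
Proof. by apply/eqP/eqP => [/eq0_normc//|->]; rewrite normc0. Qed.

Lemma normc_gt0 z : (0 < normc z) = (z != 0).
Proof. by rewrite lt0r normc_eq0 normc_ge0 andbT. Qed.

Lemma normcV z : normc z^-1 = (normc z)^-1.
Proof.
have [->|z0] := eqVneq z 0; first by rewrite !(invr0, normc0).
have nz : normc z != 0 by rewrite normc_eq0.
by apply: (mulfI nz); rewrite -normcM !mulfV// normc1.
Qed.

End ComplexModulus.

(** * The union of cycles and its counting measure *)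

Definition cycles : Type := {n : nat & 'I_n.+1}.
Definition st n (x : 'I_n.+1) : cycles := existT _ n x.

HB.instance Definition _ := Choice.on cycles.
HB.instance Definition _ := isPointed.Build cycles (@st 0 ord0).
HB.instance Definition _ := @isMeasurable.Build default_measure_display
  cycles discrete_measurable discrete_measurable0
  discrete_measurableC discrete_measurableU.

Section L1Cycles.
Context (R : realType).

Definition cmeas : set cycles -> \bar R :=
  mseries (fun n => msum (fun k => \d_(@st n (inord k))) n.+1) 0.

HB.instance Definition _ := Measure.on cmeas.

Lemma cmeasE (A : set cycles) :
  cmeas A = (\sum_(n <oo) \sum_(x < n.+1) \d_(st x) A)%E.
Proof.
apply: eq_eseriesr => n _; rewrite /= /msum.
by apply: eq_bigr => x _; rewrite inord_val.
Qed.

Let sum_dirac_ge0 n (A : set cycles) :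
  (0 <= \sum_(x < n.+1) \d_(st x) A :> \bar R)%E.
Proof. by apply: sume_ge0 => x _; rewrite diracE lee_fin. Qed.

Lemma cmeas_ge_dirac n (x : 'I_n.+1) (A : set cycles) : (\d_(st x) A <= cmeas A)%E.
Proof.
rewrite cmeasE (@nneseriesD1 _ _ n xpredT)//.
rewrite (bigD1 x)//= -addeA leeDl// adde_ge0//.
  by apply: sume_ge0 => y _; rewrite diracE lee_fin.
by apply: nneseries_ge0 => k _ _; exact: sum_dirac_ge0.
Qed.

(** Every state has mass at least 1, so only the empty set is null. Classes in [cL1] are thus
    genuine functions, which is what makes the coordinates [ev] faithful. *)
Lemma cmeas_ae (P : cycles -> Prop) : {ae cmeas, forall x, P x} <-> forall x, P x.
Proof.
split=> [[A [_ A0 PA]] [n x]|h]; last exact: aeW.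
apply: contrapT => nP.
have Ax : A (st x) by exact: PA.
have := cmeas_ge_dirac x A; rewrite A0 diracE mem_set//.
by rewrite leNgt lte01.
Qed.

Lemma cmeas_sigma_finite : sigma_finite setT cmeas.
Proof.
exists (fun k => [set x : cycles | tag x = k]).
  by apply/seteqP; split=> // -[n x] _; exists n.
move=> k; split=> //; rewrite cmeasE (@nneseriesD1 _ _ k xpredT)//.
rewrite eseries0 ?adde0; last first.
  move=> n _ /andP[_ nk]; apply: big1 => x _.
  by rewrite diracE memNset//= => nk'; rewrite nk' eqxx in nk.
rewrite (eq_bigr (fun _ => 1%:E)).
  by rewrite sumEFin ltry.
by move=> x _; rewrite diracE mem_set.
Qed.

HB.instance Definition _ := @Measure_isSigmaFinite.Build _ _ _ cmeas cmeas_sigma_finite.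

Lemma measurable_cycles (d : measure_display) (Y : measurableType d)
  (D : set cycles) (f : cycles -> Y) : measurable_fun D f.
Proof. by []. Qed.

Lemma cmeas_integral (f : cycles -> \bar R) : (forall x, 0 <= f x)%E ->
  (\int[cmeas]_x f x = \sum_(n <oo) \sum_(x < n.+1) f (st x))%E.
Proof.
move=> f0; rewrite ge0_integral_measure_series//.
apply: eq_eseriesr => n _; rewrite ge0_integral_measure_sum//.
apply: eq_bigr => x _.
by rewrite integral_dirac// diracT mul1e inord_val.
Qed.

End L1Cycles.

(** * Integrable classes as summable functions *)

Section L1Coordinates.
Context {R : realType}.
Implicit Types f g : cycles -> R[i].

Definition block_norm f n : R := \sum_(x < n.+1) normc (f (st x)).
Definition summing f := exists B, forall N, \sum_(n < N) block_norm f n <= B.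
(** A limit of partial sums, meaningful under [summing]. *)
Definition l1norm f : R := limn (series (block_norm f)).

Lemma block_norm_ge0 f n : 0 <= block_norm f n.
Proof. by apply: sumr_ge0 => x _; exact: normc_ge0. Qed.

Lemma block_norm_ndecr f : nondecreasing_seq (series (block_norm f)).
Proof. by apply: nondecreasing_series => n _ _; exact: block_norm_ge0. Qed.

Lemma summing_cvg f : summing f -> cvgn (series (block_norm f)).
Proof.
move=> [B fB]; apply: nondecreasing_is_cvgn; first exact: block_norm_ndecr.
by exists B => _ [N _ <-]; rewrite /series/= big_mkord.
Qed.

Lemma l1norm_ub f N : summing f -> \sum_(n < N) block_norm f n <= l1norm f.
Proof.
move=> /summing_cvg fc; rewrite -(big_mkord xpredT (block_norm f)).
by apply: nondecreasing_cvgn_le fc N; exact: block_norm_ndecr.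
Qed.

Lemma l1norm_ge0 f : summing f -> 0 <= l1norm f.
Proof. by move=> /(l1norm_ub 0); rewrite big_ord0. Qed.

Lemma block_norm_le f n : summing f -> block_norm f n <= l1norm f.
Proof.
move=> /(l1norm_ub n.+1); apply: le_trans.
by rewrite big_ord_recr/= lerDr sumr_ge0// => i _; exact: block_norm_ge0.
Qed.

Lemma l1norm_le f B : (forall N, \sum_(n < N) block_norm f n <= B) ->
  summing f /\ l1norm f <= B.
Proof.
move=> fB; have sf : summing f by exists B.
split=> //; apply: limr_le; first exact: summing_cvg.
by apply: nearW => N; rewrite /series/= big_mkord.
Qed.

Lemma l1norm_eseries f : summing f ->
  (\sum_(n <oo) (block_norm f n)%:E = (l1norm f)%:E)%E.
Proof.
move=> sf; apply/cvg_lim => //; apply: cvg_EFin.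
  by apply: nearW => N; apply/fin_numPlt; rewrite sumEFin ltNyr ltry.
rewrite [X in X @ _ --> _](_ : _ = series (block_norm f)); last first.
  by apply/funext => N; rewrite /= sumEFin.
exact: summing_cvg.
Qed.

Definition cmu : {sigma_finite_measure set cycles -> \bar R} := cmeas R.

Lemma cmu_integral f :
  (\int[cmu]_x (normc (f x))%:E = \sum_(n <oo) (block_norm f n)%:E)%E.
Proof.
rewrite cmeas_integral; last by move=> x; rewrite lee_fin normc_ge0.
by apply: eq_eseriesr => n _; rewrite sumEFin.
Qed.

Lemma summingP f : cintegrable cmu f <-> summing f.
Proof.
split=> [[_]|sf].
  rewrite cmu_integral => fI.
  exists (fine (\sum_(n <oo) (block_norm f n)%:E)%E) => N.
  have f0 n : (0 <= (block_norm f n)%:E)%E by rewrite lee_fin block_norm_ge0.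
  have fin : (\sum_(n <oo) (block_norm f n)%:E)%E \is a fin_num.
    by rewrite ge0_fin_numE// nneseries_ge0.
  rewrite -lee_fin fineK// -sumEFin -(big_mkord xpredT (fun n => (block_norm f n)%:E)).
  by apply: nneseries_lim_ge => n _ _.
split; first by split; exact: measurable_cycles.
by rewrite cmu_integral l1norm_eseries ?ltry.
Qed.

Notation E := (cL1 cmu).
Implicit Types u v : E.

Definition ev u : cycles -> R[i] := cL1_repr u.

(** Inverse of [ev] on summing functions; the value 0 elsewhere is a default. *)
Definition mk f : E :=
  if pselect (summing f) is left sf then
    cL1_pi (CIntFun (introT (asboolP _) (proj2 (summingP f) sf)))
  else 0.

Lemma mkK f : summing f -> ev (mk f) = f.
Proof.
rewrite /mk; case: pselect => // sf _; apply/funext.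
apply/(cmeas_ae R).
by apply: (filterS _ (cL1_repr_pi (CIntFun (introT (asboolP _) (proj2 (summingP f) sf))))).
Qed.

Lemma ev_summing u : summing (ev u).
Proof.
by apply/summingP; rewrite /ev; case: (cL1_repr u) => f /= /asboolP.
Qed.

Lemma ev_pi (f : cIntFun cmu) : ev (cL1_pi f) = f.
Proof. by apply/funext; apply/(cmeas_ae R)/cL1_repr_pi. Qed.

Lemma ev_inj : injective ev.
Proof.
move=> u v uv; rewrite -(cL1_reprK u) -(cL1_reprK v); apply/cL1_pi_eqP.
by apply: aeW => x; have := congr1 (fun h => h x) uv.
Qed.

Lemma evK u : mk (ev u) = u.
Proof. by apply: ev_inj; rewrite mkK//; exact: ev_summing. Qed.

Lemma evD u v x : ev (u + v) x = ev u x + ev v x.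
Proof.
by rewrite -[in LHS](cL1_reprK u) -[in LHS](cL1_reprK v) -cL1_piD ev_pi.
Qed.

Lemma evZ a u x : ev (a *: u) x = a * ev u x.
Proof. by rewrite [a *: u]/(cL1_scale a u) /cL1_scale ev_pi. Qed.

Lemma ev0 x : ev 0 x = 0.
Proof. by rewrite -(scale0r (0 : E)) evZ mul0r. Qed.

Lemma evN u x : ev (- u) x = - ev u x.
Proof. by rewrite -scaleN1r evZ mulN1r. Qed.

Lemma evB u v x : ev (u - v) x = ev u x - ev v x.
Proof. by rewrite evD evN. Qed.

Lemma norm_ev u : `|u| = (l1norm (ev u))%:C.
Proof.
rewrite cL1_normE /cintnorm; congr (_%:C).
by rewrite cmu_integral l1norm_eseries//; exact: ev_summing.
Qed.

Lemma cL1_ge0P u : cL1_ge0 u <-> forall x, 0 <= ev u x.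
Proof. exact: cmeas_ae. Qed.

Lemma cL1_le_absP u v : cL1_le_abs u v <-> forall x, normc (ev u x) <= normc (ev v x).
Proof.
transitivity (forall x, `|ev u x| <= `|ev v x|); first exact: cmeas_ae.
by split=> h x; move: (h x); rewrite -!Defs.normcE lecR.
Qed.

End L1Coordinates.
Arguments cmu : clear implicits.

(** * Convolution on each cycle *)

Section BlockConvolution.
Context {R : realType}.
Implicit Types f g k l : cycles -> R[i].

(** Subtraction of ordinals is modulo n+1, so on each cycle this is the product of the group algebra
    of Z/(n+1): k stands for the sum of the [k (st j)] P^j, with P the shift by one state. Then
    [block_sum] is the augmentation, the value at P = 1. *)
Definition conv k f (p : cycles) : R[i] :=
  \sum_(j < (tag p).+1) k (st j) * f (st (tagged p - j)).

Definition block_sum f n : R[i] := \sum_(x < n.+1) f (st x).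

Definition unit0 (p : cycles) : R[i] := (tagged p == 0)%:R.

Lemma convE k f n (x : 'I_n.+1) :
  conv k f (st x) = \sum_(j < n.+1) k (st j) * f (st (x - j)).
Proof. by []. Qed.

Lemma unit0E n (x : 'I_n.+1) : unit0 (st x) = (x == 0)%:R.
Proof. by []. Qed.

Lemma convC k f : conv k f = conv f k.
Proof.
apply/funext => -[n x]; rewrite !convE (reindex_inj (subrI x)).
by apply: eq_bigr => j _; rewrite subKr mulrC.
Qed.

Lemma convA k l f : conv k (conv l f) = conv (conv k l) f.
Proof.
apply/funext => -[n x]; rewrite !convE.
under eq_bigr do rewrite convE mulr_sumr.
under [RHS]eq_bigr do rewrite convE mulr_suml.
rewrite [RHS]exchange_big/=; apply: eq_bigr => j _.
rewrite [RHS](reindex_inj (addIr j))/=; apply: eq_bigr => i _.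
by rewrite addrK mulrA [i + j]addrC opprD addrA.
Qed.

Lemma conv_unit0 f : conv unit0 f = f.
Proof.
apply/funext => -[n x]; rewrite convE (bigD1 0)//= unit0E eqxx mul1r subr0.
by rewrite big1 ?addr0// => j /negbTE j0; rewrite unit0E j0 mul0r.
Qed.

Lemma convBl k l f : conv (k - l) f = conv k f - conv l f.
Proof.
apply/funext => -[n x]; transitivity (conv k f (st x) - conv l f (st x)) => //; rewrite !convE -sumrB.
by apply: eq_bigr => j _; rewrite -mulrBl.
Qed.

Lemma convDr k f g : conv k (f + g) = conv k f + conv k g.
Proof.
apply/funext => -[n x]; transitivity (conv k f (st x) + conv k g (st x)) => //; rewrite !convE -big_split/=.
by apply: eq_bigr => j _; rewrite -mulrDr.
Qed.

Lemma convZr a k f : conv k (a *: f) = a *: conv k f.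
Proof.
apply/funext => -[n x]; transitivity (a * conv k f (st x)) => //; rewrite !convE mulr_sumr.
by apply: eq_bigr => j _; rewrite mulrCA.
Qed.

Lemma convBr k f g : conv k (f - g) = conv k f - conv k g.
Proof. by rewrite -scaleN1r convDr convZr scaleN1r. Qed.

Lemma convZl a k f : conv (a *: k) f = a *: conv k f.
Proof. by rewrite convC convZr convC. Qed.

Lemma block_sum_conv k f n :
  block_sum (conv k f) n = block_sum k n * block_sum f n.
Proof.
rewrite /block_sum; under eq_bigr do rewrite convE.
rewrite exchange_big/= mulr_suml; apply: eq_bigr => j _.
by rewrite -mulr_sumr; congr *%R; rewrite [RHS](reindex_inj (addIr (- j))).
Qed.

Lemma block_sumD f g n : block_sum (f + g) n = block_sum f n + block_sum g n.
Proof. by rewrite /block_sum -big_split. Qed.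

Lemma block_sumZ a f n : block_sum (a *: f) n = a * block_sum f n.
Proof. by rewrite /block_sum mulr_sumr. Qed.

Lemma block_sumB f g n : block_sum (f - g) n = block_sum f n - block_sum g n.
Proof. by rewrite -scaleN1r block_sumD block_sumZ mulN1r. Qed.

Lemma block_sum_unit0 n : block_sum unit0 n = 1.
Proof.
rewrite /block_sum (bigD1 0)//= unit0E eqxx big1 ?addr0//.
by move=> j /negbTE j0; rewrite unit0E j0.
Qed.

Lemma normc_block_sum f n : normc (block_sum f n) <= block_norm f n.
Proof. exact: normc_sum. Qed.

Lemma block_norm_conv k f n :
  block_norm (conv k f) n <= block_norm k n * block_norm f n.
Proof.
rewrite /block_norm.
apply: (@le_trans _ _ (\sum_(x < n.+1) \sum_(j < n.+1)
    normc (k (st j)) * normc (f (st (x - j))))).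
  apply: ler_sum => x _; rewrite convE.
  by apply: (le_trans (normc_sum _ _ _)); apply: ler_sum => j _; rewrite normcM.
rewrite exchange_big/= mulr_suml; apply: ler_sum => j _.
by rewrite -mulr_sumr [X in _ <= _ * X](reindex_inj (addIr (- j))).
Qed.

Lemma block_normD f g n : block_norm (f + g) n <= block_norm f n + block_norm g n.
Proof. by rewrite /block_norm -big_split; apply: ler_sum => x _; exact: ler_normcD. Qed.

Lemma block_normZ a f n : block_norm (a *: f) n = normc a * block_norm f n.
Proof. by rewrite /block_norm mulr_sumr; apply: eq_bigr => x _; rewrite -normcM. Qed.

Lemma block_normB f g n : block_norm (f - g) n <= block_norm f n + block_norm g n.
Proof.
apply: (le_trans (block_normD _ _ _)).
by rewrite -scaleN1r block_normZ normcN normc1 mul1r.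
Qed.

Lemma block_norm_unit0 n : block_norm unit0 n = 1.
Proof.
rewrite /block_norm (bigD1 0)// unit0E eqxx normc1 big1 /= ?addr0//.
by move=> j /negbTE j0; rewrite unit0E j0 normc0.
Qed.

Lemma ge0_block_norm f n : (forall x, 0 <= f x) ->
  (block_norm f n)%:C = block_sum f n.
Proof.
move=> f0; rewrite /block_norm rmorph_sum.
by apply: eq_bigr => x _; rewrite [RHS]ge0_normc.
Qed.

End BlockConvolution.

(** * Tails of absolutely convergent complex series *)

Section Tails.
Context {R : realType}.
Implicit Types u v : nat -> R[i].

Definition abs_summable u := exists B : R, forall N, \sum_(n < N) normc (u n) <= B.

Definition series_sum u : R[i] :=
  limn (series (@complex.Re R \o u)) +i* limn (series (@complex.Im R \o u)).

(** Defined by subtraction, so that the recurrence [tailS] holds without any convergence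
    hypothesis. *)
Definition tail u n : R[i] := series_sum u - \sum_(k < n) u k.

Lemma tailS u n : tail u n = u n + tail u n.+1.
Proof. by rewrite /tail big_ord_recr/=; ring. Qed.

Lemma abs_summable_cvg u : abs_summable u -> cvgn (series (fun n => normc (u n))).
Proof.
move=> [B uB]; apply: nondecreasing_is_cvgn.
  by apply: nondecreasing_series => n _ _; exact: normc_ge0.
by exists B => _ [N _ <-]; rewrite /series/= big_mkord.
Qed.

Lemma Re_sum I (r : seq I) (P : pred I) (F : I -> R[i]) :
  complex.Re (\sum_(i <- r | P i) F i) = \sum_(i <- r | P i) complex.Re (F i).
Proof. exact: (raddf_sum (@complex.Re R)). Qed.

Lemma Im_sum I (r : seq I) (P : pred I) (F : I -> R[i]) :
  complex.Im (\sum_(i <- r | P i) F i) = \sum_(i <- r | P i) complex.Im (F i).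
Proof. exact: (raddf_sum (@complex.Im R)). Qed.

Lemma tail_cvg0 u : abs_summable u -> normc (tail u n) @[n --> \oo] --> 0.
Proof.
move=> su.
have cRe : cvgn (series (@complex.Re R \o u)).
  apply: normed_cvg.
  apply: (@series_le_cvg _ _ (fun n => normc (u n))) => [n|n|n|] /=.
  - exact: normr_ge0.
  - exact: normc_ge0.
  - exact: ler_Re_normc.
  - exact: abs_summable_cvg.
have cIm : cvgn (series (@complex.Im R \o u)).
  apply: normed_cvg.
  apply: (@series_le_cvg _ _ (fun n => normc (u n))) => [n|n|n|] /=.
  - exact: normr_ge0.
  - exact: normc_ge0.
  - exact: ler_Im_normc.
  - exact: abs_summable_cvg.
apply: (@squeeze_cvgr _ _ _ _ (fun=> 0)
   (fun n => `|limn (series (@complex.Re R \o u)) - series (@complex.Re R \o u) n| +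
             `|limn (series (@complex.Im R \o u)) - series (@complex.Im R \o u) n|)).
- apply: nearW => n; rewrite normc_ge0/=; apply: (le_trans (normc_le_Re_Im _)).
  rewrite /tail /series/= !big_mkord -Re_sum -Im_sum.
  by case: (\sum_(k < n) u k) => a b /=.
- exact: cvg_cst.
- rewrite -[X in _ --> X]addr0; apply: cvgD.
    rewrite -(normr0 R) -(subrr (limn (series (@complex.Re R \o u)))).
    by apply: cvg_norm; apply: cvgB; [exact: cvg_cst|].
  rewrite -(normr0 R) -(subrr (limn (series (@complex.Im R \o u)))).
  by apply: cvg_norm; apply: cvgB; [exact: cvg_cst|].
Qed.

(** Two solutions of the recurrence differ by a constant, which the limits force to be 0. Identities
    between tails are checked below through this recurrence instead of by manipulating series. *)
Lemma tail_uniq u (t : nat -> R[i]) : abs_summable u ->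
  (forall n, t n = u n + t n.+1) -> normc (t n) @[n --> \oo] --> 0 ->
  t = tail u.
Proof.
move=> su tS t0; apply/funext => n; apply/eqP; rewrite -subr_eq0 -normc_eq0.
have cst k : t (n + k)%N - tail u (n + k)%N = t n - tail u n.
  elim: k => [|k <-]; first by rewrite addn0.
  by rewrite addnS [t (n + k)%N]tS [tail u (n + k)%N]tailS; ring.
suff : (fun k => normc (t (n + k)%N - tail u (n + k)%N)) @ \oo --> 0.
  under eq_fun do rewrite cst.
  by move=> /(cvg_lim (@Rhausdorff _)); rewrite lim_cst// => ->.
apply: (@squeeze_cvgr _ _ _ _ (fun=> 0)
  (fun k => normc (t (n + k)%N) + normc (tail u (n + k)%N))).
- apply: nearW => k; rewrite normc_ge0/=; apply: (le_trans (ler_normcD _ _)).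
  by rewrite normcN.
- exact: cvg_cst.
- rewrite -[X in _ --> X]addr0; apply: cvgD.
    under eq_fun do rewrite addnC.
    by move: t0; rewrite -(cvg_shiftn n).
  under eq_fun do rewrite addnC.
  by have := tail_cvg0 su; rewrite -(cvg_shiftn n).
Qed.

Lemma tail_bound u B n : (forall N, (n <= N)%N -> \sum_(n <= k < N) normc (u k) <= B) ->
  abs_summable u -> normc (tail u n) <= B.
Proof.
move=> uB su.
have h k : normc (tail u n) <= B + normc (tail u (k + n)).
  have : normc (tail u n) <=
      \sum_(n <= j < k + n) normc (u j) + normc (tail u (k + n)).
    elim: k => [|k IH]; first by rewrite add0n big_geq// add0r.
    apply: (le_trans IH); rewrite addSn big_nat_recr ?leq_addl//=.
    rewrite -addrA lerD2l [tail u (k + n)]tailS; exact: ler_normcD.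
  by move=> /le_trans; apply; rewrite lerD2r uB// leq_addl.
have : (fun k => B + normc (tail u (k + n))) @ \oo --> B + 0.
  apply: cvgD; first exact: cvg_cst.
  by have := tail_cvg0 su; rewrite -(cvg_shiftn n).
rewrite addr0 => cB; rewrite -(cvg_lim (@Rhausdorff _) cB).
by apply: limr_ge; [apply/cvg_ex; exists B|exact: nearW].
Qed.

End Tails.

Section TailPositivity.
Context {R : realType}.
Implicit Types (u : nat -> R[i]).

Lemma tail_split u n k : tail u n = \sum_(n <= j < n + k) u j + tail u (n + k).
Proof.
elim: k => [|k IH]; first by rewrite addn0 big_geq// add0r.
by rewrite IH addnS big_nat_recr ?leq_addr//= [tail u (n + k)]tailS addrA.
Qed.

Lemma tail_ge0 u n : abs_summable u -> (forall k, 0 <= u k) -> 0 <= tail u n.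
Proof.
move=> su u0.
have c0 : (fun k => normc (tail u (n + k))) @ \oo --> 0.
  under eq_fun do rewrite addnC.
  by have := tail_cvg0 su; rewrite -(cvg_shiftn n).
have sr k : \sum_(n <= j < n + k) u j = (normc (\sum_(n <= j < n + k) u j))%:C.
  by apply: ge0_normc; apply: sumr_ge0.
(* The partial sums are real and nonnegative, so the imaginary part of the tail and the opposite of
   its real part are bounded by the moduli of later tails, which tend to 0. *)
rewrite lecE/=; apply/andP; split.
  rewrite -normr_eq0 eq_le normr_ge0 andbT.
  rewrite -(cvg_lim (@Rhausdorff _) c0); apply: limr_ge; first by apply/cvg_ex; exists 0.
  apply: nearW => k; rewrite (tail_split u n k) sr raddfD/= add0r.
  exact: ler_Im_normc.
rewrite -oppr_le0 -(cvg_lim (@Rhausdorff _) c0).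
apply: limr_ge; first by apply/cvg_ex; exists 0.
apply: nearW => k; rewrite (tail_split u n k) sr raddfD/=.
apply: (@le_trans _ _ (- complex.Re (tail u (n + k)))).
  by rewrite lerN2 lerDr normc_ge0.
by apply: le_trans (ler_Re_normc _); rewrite -normrN ler_norm.
Qed.

Lemma tail_ge_term u n k : abs_summable u -> (forall k, 0 <= u k) ->
  (n <= k)%N -> u k <= tail u n.
Proof.
move=> su u0 nk; rewrite (tail_split u n (k - n).+1).
rewrite addnS big_nat_recr ?leq_addr//= subnKC// -addrA addrCA lerDl.
by rewrite addr_ge0 ?sumr_ge0 ?tail_ge0.
Qed.

End TailPositivity.

Lemma tail_linear {R : realType} (a : R[i]) (u v : nat -> R[i]) :
  abs_summable u -> abs_summable v ->
  forall n, tail (fun k => a * u k + v k) n = a * tail u n + tail v n.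
Proof.
move=> su sv n; rewrite -(@tail_uniq _ _ (fun n => a * tail u n + tail v n))//.
- have [B uB] := su; have [B' vB] := sv; exists (normc a * B + B') => N.
  apply: (@le_trans _ _ (\sum_(k < N) (normc a * normc (u k) + normc (v k)))).
    by apply: ler_sum => k _; apply: (le_trans (ler_normcD _ _)); rewrite normcM.
  rewrite big_split/= -mulr_sumr; apply: lerD; last exact: vB.
  by rewrite ler_wpM2l ?normc_ge0//; exact: uB.
- by move=> k; rewrite [tail u k]tailS [tail v k]tailS; ring.
- apply: (@squeeze_cvgr _ _ _ _ (fun=> 0)
    (fun n => normc a * normc (tail u n) + normc (tail v n))).
  + apply: nearW => k; rewrite normc_ge0/=; apply: (le_trans (ler_normcD _ _)).
    by rewrite normcM.
  + exact: cvg_cst.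
  + rewrite -[X in _ --> X]addr0 -[X in _ --> X + _](mulr0 (normc a)).
    apply: cvgD; last exact: tail_cvg0.
    by apply: cvgM; [exact: cvg_cst|exact: tail_cvg0].
Qed.

Lemma tail0 {R : realType} n : tail (fun=> 0 : R[i]) n = 0.
Proof.
rewrite -(@tail_uniq _ (fun=> 0) (fun=> 0))//.
- by exists 0 => N; rewrite big1// => i _; rewrite normc0.
- by move=> k; rewrite addr0.
- by rewrite normc0; exact: cvg_cst.
Qed.

Lemma tailZ {R : realType} (a : R[i]) (u : nat -> R[i]) n :
  abs_summable u -> tail (fun k => a * u k) n = a * tail u n.
Proof.
move=> su; rewrite -[RHS]addr0 -[X in _ = _ + X](tail0 n) -tail_linear//.
  by congr tail; apply/funext => k; rewrite addr0.
by exists 0 => N; rewrite big1// => i _; rewrite normc0.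
Qed.

(** * The functional calculus and its bounds *)

Section Multipliers.
Context {R : realType}.
Implicit Types k l f g : cycles -> R[i].

Definition rate n : R := n.+1%:R^-1.

Definition rate_gap n : R := rate n - rate n.+1.

Lemma rate_gt0 n : 0 < rate n.
Proof. by rewrite invr_gt0. Qed.

Lemma rate_le1 n : rate n <= 1.
Proof. by rewrite invf_le1// ler1n. Qed.

Lemma rate_gap_gt0 n : 0 < rate_gap n.
Proof. by rewrite subr_gt0 ltf_pV2 ?posrE// ltr_nat. Qed.

Lemma sum_rate_gap N : \sum_(n < N) rate_gap n = 1 - rate N.
Proof.
elim: N => [|N IH]; first by rewrite big_ord0 /rate invr1 subrr.
by rewrite big_ord_recr/= IH /rate_gap addrA subrK.
Qed.

Lemma sum_rate_gap_le1 N : \sum_(n < N) rate_gap n <= 1.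
Proof. by rewrite sum_rate_gap gerBl ltW ?rate_gt0. Qed.

(* the number of states in the first N cycles *)
Definition vol N : R := \sum_(n < N) n.+1%:R.

Lemma volS N : vol N.+1 = vol N + N.+1%:R.
Proof. by rewrite /vol big_ord_recr. Qed.

Lemma vol_ge0 N : 0 <= vol N.
Proof. by apply: sumr_ge0. Qed.

Lemma volS_ge1 N : 1 <= vol N.+1.
Proof. by rewrite volS ler_wpDl ?vol_ge0// ler1n. Qed.

Lemma volS_gt0 N : 0 < vol N.+1.
Proof. exact: lt_le_trans ltr01 (volS_ge1 N). Qed.

Lemma vol_le M N : (M <= N)%N -> vol M <= vol N.
Proof.
move=> /subnK <-; elim: (N - M)%N => [|j IH]; first by rewrite add0n.
by apply: (le_trans IH); rewrite addSn volS lerDl.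
Qed.

Definition psum f n : R[i] := \sum_(j < n.+1) block_sum f j.
Definition jump k n : R[i] := block_sum k n.+1 - block_sum k n.
(** Contribution of level n: the average of f over the first n+1 cycles, weighted by the increment
    of the value of k at P = 1. No finer information on k enters, as averages are constant on
    cycles. *)
Definition coupling k f n : R[i] := jump k n * (psum f n / (vol n.+1)%:C).

(* For k the kernel of e^(t(r(P-1)-b)), where P rotates each cycle by one state,
   this is the product of two commuting evolutions: rotating the n-th cycle at
   rate r_n, and, for each N, replacing at rate b_N - b_(N+1) a state of the
   first N+1 cycles by a uniformly distributed one. In general it is the value
   at k of a functional calculus for these operators, with [conv] as product
   (lemma [mult_conv]). *)
Definition mult k f (p : cycles) : R[i] :=
  conv k f p + tail (coupling k f) (tag p).

(** The gaps sum to at most 1, so the second condition lets the averages contribute at most C times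
    the norm of f. It suits kernels whose block sums are Lipschitz functions of [rate n], as those
    of the semigroup and of the resolvent will be. *)
Definition controlled C k := (forall n, block_norm k n <= C) /\
  (forall n, normc (jump k n) <= C * rate_gap n).

Lemma controlled_ge0 C k : controlled C k -> 0 <= C.
Proof. by move=> [/(_ 0)] + _; exact: le_trans (block_norm_ge0 _ _). Qed.

Lemma psum_le f n : summing f -> normc (psum f n) <= l1norm f.
Proof.
move=> /(@l1norm_ub _ _ n.+1); apply: le_trans.
apply: (le_trans (normc_sum _ _ _)); apply: ler_sum => j _.
exact: normc_block_sum.
Qed.

Lemma psumD f g n : psum (f + g) n = psum f n + psum g n.
Proof. by rewrite /psum -big_split/=; apply: eq_bigr => j _; rewrite block_sumD. Qed.

Lemma psumZ a f n : psum (a *: f) n = a * psum f n.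
Proof. by rewrite /psum mulr_sumr/=; apply: eq_bigr => j _; rewrite block_sumZ. Qed.

Lemma normc_coupling k f n :
  normc (coupling k f n) = normc (jump k n) * normc (psum f n) / vol n.+1.
Proof.
rewrite !normcM normcV normcC mulrA ger0_norm//.
exact/ltW/volS_gt0.
Qed.

Lemma normc_coupling_le k f n :
  normc (coupling k f n) <= normc (jump k n) * normc (psum f n).
Proof.
rewrite normc_coupling ler_pdivrMr ?volS_gt0// ler_peMr ?volS_ge1//.
by rewrite mulr_ge0// normc_ge0.
Qed.

Lemma sum_jump_psum C k f N : controlled C k -> summing f ->
  \sum_(n < N) normc (jump k n) * normc (psum f n) <= C * l1norm f.
Proof.
move=> ck sf; apply: (@le_trans _ _ (\sum_(n < N) C * l1norm f * rate_gap n)).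
  apply: ler_sum => n _; rewrite mulrAC.
  by apply: ler_pM; rewrite ?normc_ge0//; [apply ck|exact: psum_le].
rewrite -mulr_sumr ler_piMr ?sum_rate_gap_le1// mulr_ge0 ?l1norm_ge0//.
exact: controlled_ge0 ck.
Qed.

Lemma coupling_summable C k f : controlled C k -> summing f ->
  abs_summable (coupling k f).
Proof.
move=> ck sf; exists (C * l1norm f) => N; apply: le_trans (sum_jump_psum N ck sf).
by apply: ler_sum => n _; exact: normc_coupling_le.
Qed.

(** Summation by parts: after exchanging the sums, the term of index j is counted [vol j.+1] times,
    which cancels the denominator in [coupling]. *)
Lemma sum_tail_coupling k f B N : abs_summable (coupling k f) ->
  (forall N, \sum_(n < N) normc (jump k n) * normc (psum f n) <= B) ->
  \sum_(n < N) n.+1%:R * normc (tail (coupling k f) n) <= B.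
Proof.
move=> sc hB; set G := tail _.
have h : \sum_(n < N) n.+1%:R * normc (G n) <=
    \sum_(n < N) normc (jump k n) * normc (psum f n) + vol N * normc (G N).
  elim: N => [|N IH]; first by rewrite !big_ord0 add0r mulr_ge0 ?vol_ge0 ?normc_ge0.
  rewrite !big_ord_recr/=; apply: (le_trans (lerD IH (lexx _))).
  rewrite -!addrA lerD2l -mulrDl -volS.
  apply: (@le_trans _ _ (vol N.+1 * (normc (coupling k f N) + normc (G N.+1)))).
    by rewrite ler_pM2l ?volS_gt0// {1}/G tailS; exact: ler_normcD.
  rewrite mulrDr normc_coupling lerD2r mulrC mulfVK//.
  by rewrite gt_eqF ?volS_gt0.
apply: (le_trans h); case: N {h} => [|N].
  by rewrite /vol !big_ord0 mul0r addr0; have := hB 0; rewrite big_ord0.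
(* The boundary term is absorbed by the terms of index j from [N.+1] on, where [vol N.+1 / vol j.+1]
   is at most 1. *)
rewrite -lerBrDl -ler_pdivlMl ?volS_gt0//.
apply: tail_bound => // M NM; rewrite ler_pdivlMl ?volS_gt0// lerBrDl.
apply: le_trans (hB M).
rewrite -[in leRHS](big_mkord xpredT (fun n => normc (jump k n) * normc (psum f n))).
rewrite [in leRHS](@big_cat_nat _ _ _ N.+1)//= [in leRHS]big_mkord lerD2l mulr_sumr.
apply: ler_sum_nat => j /andP[Nj _].
rewrite normc_coupling mulrCA ler_piMr ?mulr_ge0 ?normc_ge0//.
by rewrite ler_pdivrMr ?volS_gt0// mul1r vol_le// ltnW.
Qed.

Lemma block_norm_cst (c : nat -> R[i]) n :
  block_norm (fun p => c (tag p)) n = n.+1%:R * normc (c n).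
Proof. by rewrite /block_norm (eq_bigr (fun=> normc (c n)))// sumr_const card_ord mulr_natl. Qed.

Lemma block_sum_cst (c : nat -> R[i]) n :
  block_sum (fun p => c (tag p)) n = n.+1%:R * c n.
Proof. by rewrite /block_sum (eq_bigr (fun=> c n))// sumr_const card_ord mulr_natl. Qed.

Lemma multE k f : mult k f = conv k f + (fun p => tail (coupling k f) (tag p)).
Proof. by []. Qed.

Lemma mult_bound C k f B B' : controlled C k -> summing f ->
  (forall N, \sum_(n < N) block_norm k n * block_norm f n <= B) ->
  (forall N, \sum_(n < N) normc (jump k n) * normc (psum f n) <= B') ->
  summing (mult k f) /\ l1norm (mult k f) <= B + B'.
Proof.
move=> ck sf hB hB'; apply: l1norm_le => N.
apply: le_trans (lerD (hB N) (sum_tail_coupling N (coupling_summable ck sf) hB')).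
rewrite -big_split; apply: ler_sum => n _.
rewrite multE; apply: (le_trans (block_normD _ _ _)).
by rewrite block_norm_cst lerD2r block_norm_conv.
Qed.

Lemma mult_le C k f : controlled C k -> summing f ->
  summing (mult k f) /\ l1norm (mult k f) <= (2 * C) * l1norm f.
Proof.
move=> ck sf; rewrite mulr2n mulrDl mul1r mulrDl.
apply: (@mult_bound C) => // N; last exact: sum_jump_psum.
apply: (@le_trans _ _ (\sum_(n < N) C * block_norm f n)).
  by apply: ler_sum => n _; rewrite ler_wpM2r ?block_norm_ge0//; apply ck.
by rewrite -mulr_sumr ler_wpM2l ?(controlled_ge0 ck)// l1norm_ub.
Qed.

Lemma mult_linear C k a f g : controlled C k -> summing f -> summing g ->
  mult k (a *: f + g) = a *: mult k f + mult k g.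
Proof.
move=> ck sf sg; apply/funext => p; rewrite /mult convDr convZr.
transitivity (a * (conv k f p + tail (coupling k f) (tag p))
              + (conv k g p + tail (coupling k g) (tag p))) => //.
rewrite mulrDr [RHS]addrACA; congr (_ + _) => //.
rewrite -tail_linear; [|exact: coupling_summable ck _..].
congr tail; apply/funext => n; rewrite /coupling psumD psumZ; ring.
Qed.

Lemma jumpB k l n : jump (k - l) n = jump k n - jump l n.
Proof. by rewrite /jump !block_sumB; ring. Qed.

Lemma jumpZ a k n : jump (a *: k) n = a * jump k n.
Proof. by rewrite /jump !block_sumZ; ring. Qed.

Lemma controlledB C D k l : controlled C k -> controlled D l ->
  controlled (C + D) (k - l).
Proof.
move=> [kC jC] [lD jD]; split=> n.
  by apply: (le_trans (block_normB _ _ _)); exact: lerD.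
rewrite jumpB; apply: (le_trans (ler_normcD _ _)).
by rewrite normcN mulrDl lerD.
Qed.

Lemma controlledZ C a k : controlled C k -> controlled (normc a * C) (a *: k).
Proof.
move=> [kC jC]; split=> n.
  by rewrite block_normZ ler_wpM2l ?normc_ge0.
by rewrite jumpZ normcM -mulrA ler_wpM2l ?normc_ge0.
Qed.

Lemma mult_lin_ker C D a k l f : controlled C k -> controlled D l -> summing f ->
  mult (a *: k - l) f = a *: mult k f - mult l f.
Proof.
move=> ck dl sf; apply/funext => p; rewrite /mult convBl convZl.
transitivity (a * (conv k f p + tail (coupling k f) (tag p))
              - (conv l f p + tail (coupling l f) (tag p))) => //.
transitivity (a * conv k f p - conv l f p + tail (coupling (a *: k - l) f) (tag p)) => //.
rewrite mulrDr opprD [RHS]addrACA; congr (_ + _) => //.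
rewrite [RHS]addrC -[X in _ = X + _]mulN1r -(tailZ a); last exact: coupling_summable ck _.
have -> : (fun n => a * coupling k f n) = coupling (a *: k) f.
  by apply/funext => n; rewrite /coupling jumpZ; ring.
rewrite -tail_linear.
- congr tail; apply/funext => n; rewrite /coupling jumpB jumpZ; ring.
- exact: coupling_summable dl _.
- by apply: coupling_summable sf; exact: controlledZ ck.
Qed.

(** Levels below n only move mass inside the first n+1 cycles, so by summation by parts they leave
    the single factor [block_sum k n]. Levels from n on give the same value to each of the
    [vol n.+1] states. *)
Lemma psum_mult C k f n : controlled C k -> summing f ->
  psum (mult k f) n =
  block_sum k n * psum f n + (vol n.+1)%:C * tail (coupling k f) n.
Proof.
move=> ck sf; elim: n => [|n IH].
  rewrite /psum !big_ord_recl !big_ord0 !addr0 multE block_sumD block_sum_conv.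
  by rewrite block_sum_cst /vol big_ord_recl big_ord0 addr0.
rewrite [LHS]/psum big_ord_recr/= -[X in X + _]/(psum (mult k f) n) IH.
rewrite multE block_sumD block_sum_conv block_sum_cst.
have -> : psum f n.+1 = psum f n + block_sum f n.+1 by rewrite /psum big_ord_recr.
rewrite (volS n.+1) tailS /coupling /jump rmorphD/= rmorph_nat.
have v0 : (vol n.+1)%:C != 0 by rewrite fmorph_eq0 gt_eqF// volS_gt0.
by field.
Qed.

Lemma normc_block_sum_le C k n : controlled C k -> normc (block_sum k n) <= C.
Proof. by move=> [kC _]; exact: le_trans (normc_block_sum _ _) (kC n). Qed.

Lemma controlled_conv C D k l : controlled C k -> controlled D l ->
  controlled (2 * (C * D)) (conv k l).
Proof.
move=> ck dl.
have C0 := controlled_ge0 ck; have D0 := controlled_ge0 dl.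
split=> n.
  apply: (le_trans (block_norm_conv _ _ _)).
  apply: (@le_trans _ _ (C * D)).
    by apply: ler_pM; rewrite ?block_norm_ge0//; [apply ck|apply dl].
  by rewrite ler_peMl ?mulr_ge0// ler1n.
have -> : jump (conv k l) n =
    block_sum k n.+1 * jump l n + jump k n * block_sum l n.
  by rewrite /jump !block_sum_conv; ring.
apply: (le_trans (ler_normcD _ _)); rewrite !normcM mulrDl mul1r mulrDl.
apply: lerD.
  rewrite -mulrA; apply: ler_pM; rewrite ?normc_ge0//; last by apply dl.
  exact: normc_block_sum_le ck.
rewrite mulrAC; apply: ler_pM; rewrite ?normc_ge0//; first by apply ck.
exact: normc_block_sum_le dl.
Qed.

Lemma conv_cst k (c : nat -> R[i]) :
  conv k (fun p => c (tag p)) = (fun p => block_sum k (tag p) * c (tag p)).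
Proof. by apply/funext => -[n x]; rewrite convE/= -mulr_suml. Qed.

Lemma mult_conv C D k l f : controlled C k -> controlled D l -> summing f ->
  mult k (mult l f) = mult (conv k l) f.
Proof.
move=> ck dl sf.
have [sm _] := mult_le dl sf.
apply/funext => p.
rewrite [LHS]/mult {1}multE convDr convA conv_cst.
transitivity (conv (conv k l) f p + block_sum k (tag p) * tail (coupling l f) (tag p)
  + tail (coupling k (mult l f)) (tag p)) => //.
rewrite -addrA /mult; congr (_ + _).
(* The candidate tail: k applied to the averages already produced by l, plus the averages of
   [mult l f]. By [tail_uniq] its recurrence is enough, and there [psum_mult] supplies the mass of
   [mult l f]. *)
set t := (fun n => block_sum k n * tail (coupling l f) n + tail (coupling k (mult l f)) n).
rewrite -[LHS]/(t (tag p)); congr (_ (tag p)).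
apply: tail_uniq.
- apply: coupling_summable sf; exact: controlled_conv ck dl.
- move=> n; rewrite /t [tail (coupling k _) n]tailS.
  have -> : coupling k (mult l f) n = jump k n *
      ((block_sum l n * psum f n + (vol n.+1)%:C * tail (coupling l f) n)
       / (vol n.+1)%:C) by rewrite -(psum_mult _ dl).
  rewrite [tail (coupling l f) n]tailS.
  set x := tail (coupling k _) _; set y := tail (coupling l f) _.
  rewrite /coupling /jump !block_sum_conv.
  have v0 : (vol n.+1)%:C != 0 by rewrite fmorph_eq0 gt_eqF// volS_gt0.
  by field.
- apply: (@squeeze_cvgr _ _ _ _ (fun=> 0)
    (fun n => C * normc (tail (coupling l f) n)
              + normc (tail (coupling k (mult l f)) n))).
  + apply: nearW => n; rewrite normc_ge0/=; apply: (le_trans (ler_normcD _ _)).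
    rewrite lerD2r normcM ler_wpM2r ?normc_ge0//.
    exact: normc_block_sum_le ck.
  + exact: cvg_cst.
  + rewrite -[X in _ --> X]addr0 -[X in _ --> X + _](mulr0 C).
    apply: cvgD; last by apply: tail_cvg0; exact: coupling_summable ck _.
    apply: cvgM; first exact: cvg_cst.
    by apply: tail_cvg0; exact: coupling_summable dl _.
Qed.

Lemma controlled_unit0 : controlled 1 (@unit0 R).
Proof.
split=> n; first by rewrite block_norm_unit0.
by rewrite /jump !block_sum_unit0 subrr normc0 mul1r ltW// rate_gap_gt0.
Qed.

Lemma mult_unit0 f : mult unit0 f = f.
Proof.
apply/funext => p; rewrite /mult conv_unit0.
rewrite [coupling _ _](_ : _ = fun=> 0) ?tail0 ?addr0//.
by apply/funext => n; rewrite /coupling /jump !block_sum_unit0 subrr mul0r.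
Qed.

End Multipliers.

(** * Strong convergence from entrywise convergence of kernels *)

Section DominatedConvergence.
Context {R : realType} {I : Type} (F : set_system I) {FF : Filter F}.

(** Beyond some K the sum costs at most e/2 for all i concerned, because of w; the finitely many
    remaining terms tend to 0. The choice of i does not depend on N, as a bound on a norm
    requires. *)
Lemma dominated_sum_cvg0 (u : I -> nat -> R) (w : nat -> R) C W e :
  (forall n, 0 <= w n) -> (forall N, \sum_(n < N) w n <= W) ->
  (\forall i \near F, forall n, 0 <= u i n <= C) ->
  (forall n, u i n @[i --> F] --> 0) -> 0 < e ->
  \forall i \near F, forall N, \sum_(n < N) u i n * w n <= e.
Proof.
move=> w0 wW uC ucv e0.
have [C0|C0] := leP C 0.
  apply: filterS uC => i uiC N; rewrite big1 ?ltW// => n _.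
  have /andP[u0 uC'] := uiC n.
  by rewrite (@le_anti _ _ (u i n) 0) ?mul0r// u0 (le_trans uC').
have nd : nondecreasing_seq (series w) by apply: nondecreasing_series => n _ _.
have cw : cvgn (series w).
  apply: nondecreasing_is_cvgn => //.
  by exists W => _ [N _ <-]; rewrite /series/= big_mkord.
have e2 : 0 < e / (2 * C) by rewrite divr_gt0// mulr_gt0.
have /cvgrPdist_le/(_ _ e2) [K _ hK] : series w @ \oo --> limn (series w) by [].
have tw N : (K <= N)%N -> \sum_(K <= n < N) w n <= e / (2 * C).
  move=> KN; have := hK K (leqnn K); rewrite /= => /(le_trans (ler_norm _)).
  apply: le_trans.
  rewrite lerBrDl; apply: le_trans (nondecreasing_cvgn_le nd cw N).
  by rewrite /series/= -big_cat_nat.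
have : \sum_(n < K) u i n * w n @[i --> F] --> \sum_(n < K) 0 * w n.
  apply: cvg_big => // [|n _]; first by apply: add_continuous.
  by apply: cvgMl; exact: ucv.
rewrite big1 => [|n _]; last by rewrite mul0r.
have e2' : 0 < e / 2 by rewrite divr_gt0.
move=> /cvgrPdist_le/(_ _ e2') hF.
apply: filterS2 uC hF => i uiC; rewrite sub0r normrN => hi N.
have t0 n : 0 <= u i n * w n by rewrite mulr_ge0//; have /andP[] := uiC n.
apply: (@le_trans _ _ (\sum_(n < maxn K N) u i n * w n)).
  rewrite -!(big_mkord xpredT (fun n => u i n * w n)).
  rewrite [leRHS](@big_cat_nat _ _ _ N)//= ?leq_maxr// lerDl.
  by apply: sumr_ge0 => n _.
rewrite -!(big_mkord xpredT (fun n => u i n * w n)).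
rewrite [leLHS](@big_cat_nat _ _ _ K)//= ?leq_maxl//.
rewrite [leRHS]splitr lerD//.
  by rewrite big_mkord; apply: le_trans hi; exact: ler_norm.
apply: (@le_trans _ _ (C * \sum_(K <= n < maxn K N) w n)).
  rewrite mulr_sumr; apply: ler_sum => n _.
  by rewrite ler_wpM2r//; have /andP[] := uiC n.
apply: (@le_trans _ _ (C * (e / (2 * C)))).
  by rewrite ler_pM2l// tw// leq_maxl.
suff -> : C * (e / (2 * C)) = e / 2 by [].
by field; rewrite gt_eqF.
Qed.

Lemma block_norm_cvg0 (k : I -> cycles -> R[i]) n :
  (forall p, normc (k i p) @[i --> F] --> 0) ->
  block_norm (k i) n @[i --> F] --> 0.
Proof.
move=> k0; rewrite /block_norm.
have : \sum_(x < n.+1) normc (k i (st x)) @[i --> F] --> \sum_(x < n.+1) (0 : R).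
  by apply: cvg_big => //; apply: add_continuous.
by rewrite big1.
Qed.

(** The blocks are summed against [block_norm f]; the jumps, divided by [rate_gap], against
    [rate_gap n * normc (psum f n)]. Both weights are summable, and the common control C is the
    domination. *)
Lemma mult_cvg0 C (k : I -> cycles -> R[i]) f e :
  (\forall i \near F, controlled C (k i)) ->
  (forall p, normc (k i p) @[i --> F] --> 0) ->
  summing f -> 0 < e ->
  \forall i \near F, summing (mult (k i) f) /\ l1norm (mult (k i) f) <= e.
Proof.
move=> kC k0 sf e0.
have e2 : 0 < e / 2 by rewrite divr_gt0.
have h1 : \forall i \near F, forall N,
    \sum_(n < N) block_norm (k i) n * block_norm f n <= e / 2.
  apply: (@dominated_sum_cvg0 (fun i => block_norm (k i)) (block_norm f) C (l1norm f)) => //.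
  - by move=> n; exact: block_norm_ge0.
  - by move=> N; exact: l1norm_ub.
  - by apply: filterS kC => i [kC _] n; rewrite block_norm_ge0 kC.
  - by move=> n; exact: block_norm_cvg0.
have h2 : \forall i \near F, forall N,
    \sum_(n < N) (normc (jump (k i) n) / rate_gap n) *
                 (rate_gap n * normc (psum f n)) <= e / 2.
  apply: (@dominated_sum_cvg0 (fun i n => normc (jump (k i) n) / rate_gap n)
    (fun n => rate_gap n * normc (psum f n)) C (l1norm f)) => //.
  - by move=> n; rewrite mulr_ge0 ?normc_ge0// ltW// rate_gap_gt0.
  - move=> N; apply: (@le_trans _ _ (\sum_(n < N) rate_gap n * l1norm f)).
      by apply: ler_sum => n _; rewrite ler_wpM2l ?psum_le// ltW// rate_gap_gt0.
    by rewrite -mulr_suml ler_piMl ?l1norm_ge0// sum_rate_gap_le1.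
  - apply: filterS kC => i [_ jC] n.
    by rewrite divr_ge0 ?normc_ge0 ?(ltW (rate_gap_gt0 _))//= ler_pdivrMr ?rate_gap_gt0.
  - move=> n; rewrite -[X in _ --> X](mul0r (rate_gap n)^-1); apply: cvgMl.
    apply: (@squeeze_cvgr _ _ _ _ (fun=> 0)
      (fun i => block_norm (k i) n.+1 + block_norm (k i) n)).
    + apply: nearW => i; rewrite normc_ge0/=; apply: (le_trans (ler_normcD _ _)).
      by rewrite normcN lerD// normc_block_sum.
    + exact: cvg_cst.
    + by rewrite -[X in _ --> X]addr0; apply: cvgD; exact: block_norm_cvg0.
apply: filterS3 kC h1 h2 => i kC h1 h2; rewrite [e]splitr.
apply: (mult_bound kC sf h1) => N; apply: le_trans (h2 N).
apply: ler_sum => n _; rewrite mulrA divfK//.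
by rewrite gt_eqF// rate_gap_gt0.
Qed.

End DominatedConvergence.

(** * The exponential in the group algebra of a cyclic group *)

Section CyclicExponential.
Context {R : realType} {n : nat}.
Implicit Types (j : 'I_n.+1) (y s t : R).

Definition cyc_coeff j k : R := (inZp k == j)%:R * (k`!%:R)^-1.

(* the coefficient of P^j in exp(y P), where P^(n+1) = 1 *)
Definition cyc_exp j y : R := limn (pseries (cyc_coeff j) y).

Lemma cyc_coeff_ge0 j k : 0 <= cyc_coeff j k.
Proof. by rewrite mulr_ge0 ?invr_ge0. Qed.

Lemma cyc_coeff_le j k : cyc_coeff j k <= (k`!%:R)^-1.
Proof. by rewrite ler_piMl// lern1 leq_b1. Qed.

Lemma is_cvg_cyc_exp j y : cvgn (pseries (cyc_coeff j) y).
Proof.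
apply: normed_cvg; apply: (@series_le_cvg _ _ (exp_coeff `|y|)) => [k|k|k|].
- exact: normr_ge0.
- exact: exp_coeff_ge0.
- rewrite /= normrM normrX [`|cyc_coeff _ _|]ger0_norm ?cyc_coeff_ge0//.
  by rewrite /exp_coeff/= mulrC ler_wpM2l ?exprn_ge0// cyc_coeff_le.
- exact: is_cvg_series_exp_coeff.
Qed.

(** The identity (exp(y P))' = P exp(y P), read on coefficients. *)
Lemma pseries_diffs_cyc j : pseries_diffs (cyc_coeff j) = cyc_coeff (j - inZp 1).
Proof.
apply/funext => k; rewrite /pseries_diffs /cyc_coeff.
have -> : (inZp k.+1 == j) = (inZp k == j - inZp 1).
  rewrite [RHS]eq_sym subr_eq eq_sym; congr (_ == _); apply: val_inj => /=.
  by rewrite modnDm addn1.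
by rewrite mulrCA factS natrM invfM mulVKf// pnatr_eq0.
Qed.

Lemma is_derive_cyc_exp j y :
  is_derive y 1 (cyc_exp j) (cyc_exp (j - inZp 1) y).
Proof.
rewrite /cyc_exp -pseries_diffs_cyc.
apply: (@pseries_snd_diffs _ _ (`|y| + 1)); rewrite ?pseries_diffs_cyc;
  [exact: is_cvg_cyc_exp..|].
by rewrite [ltRHS]ger0_norm// ltrDl.
Qed.

Lemma cyc_exp0 j : cyc_exp j 0 = (j == 0)%:R.
Proof.
apply: (@lim_near_cst _ (@Rhausdorff R)).
near=> N; rewrite /pseries /series/=.
have N0 : (0 < N)%N by near: N; exists 1%N.
rewrite -(prednK N0) big_nat_recl//= expr0 mulr1 big1 ?addr0.
  rewrite /cyc_coeff fact0 invr1 mulr1 eq_sym; congr ((_ == _)%:R).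
  exact: val_inj.
by move=> k _; rewrite expr0n mulr0.
Unshelve. all: by end_near. Qed.

Lemma cyc_exp_ge0 j y : 0 <= y -> 0 <= cyc_exp j y.
Proof.
move=> y0; apply: limr_ge; first exact: is_cvg_cyc_exp.
apply: nearW => N; apply: sumr_ge0 => k _.
by rewrite mulr_ge0 ?cyc_coeff_ge0 ?exprn_ge0.
Qed.

Lemma sum_cyc_exp y : \sum_j cyc_exp j y = expR y.
Proof.
have : \sum_j pseries (cyc_coeff j) y N @[N --> \oo] --> \sum_j cyc_exp j y.
  apply: cvg_big => //; first by apply: add_continuous.
  by move=> j _; exact: is_cvg_cyc_exp.
move=> /(cvg_lim (@Rhausdorff R)) <-; rewrite /expR.
congr (limn _); apply/funext => N; rewrite /pseries /series/=.
rewrite exchange_big/=; apply: eq_bigr => k _; rewrite -mulr_suml mulrC.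
congr *%R; rewrite /cyc_coeff -mulr_suml (bigD1 (inZp k))//= eqxx.
by rewrite big1 ?addr0 ?mul1r// => j /negbTE; rewrite eq_sym => ->.
Qed.

Lemma cyc_expD j s t :
  cyc_exp j (s + t) = \sum_i cyc_exp i s * cyc_exp (j - i) t.
Proof.
(* The sum of the [phi i] interpolates between the two sides: it is the left one at x = 0, the right
   one at x = t, and its derivative cancels after a shift of the index. *)
pose phi i x := cyc_exp i (s + t - x) * cyc_exp (j - i) x.
have dphi (x : R) : is_derive x (1 : R) (\sum_i phi i) 0.
  have d1 i : is_derive x (1 : R) (phi i)
      (cyc_exp i (s + t - x) * cyc_exp (j - i - inZp 1) x
       - cyc_exp (i - inZp 1) (s + t - x) * cyc_exp (j - i) x).
    have da : is_derive x (1 : R) (fun x => s + t - x) (- 1).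
      by rewrite -[- 1]add0r; apply: is_deriveD.
    have db := is_derive_cyc_exp i (s + t - x).
    have dc := is_derive_cyc_exp (j - i) x.
    have dd := @is_derive1_comp _ (cyc_exp i) (fun x => s + t - x) x _ _ db da.
    have de : is_derive x (1 : R) (phi i) _ := is_deriveM dd dc.
    apply: (is_derive_eq de); rewrite /= /GRing.scale/=; ring.
  have ds : is_derive x (1 : R) (\sum_i phi i) _ := is_derive_sum d1.
  apply: (is_derive_eq ds); rewrite big_split/= sumrN.
  rewrite [X in _ - X](reindex_inj (addIr (inZp 1)))/= -sumrB big1// => i _.
  by rewrite addrK opprD addrA subrr.
have := @is_derive_0_is_cst _ _ 0 t dphi.
rewrite !fct_sumE /phi.
under eq_bigr do rewrite subr0 cyc_exp0.
rewrite (bigD1 j)//= subrr eqxx mulr1 big1 ?addr0; last first.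
  by move=> i ij; rewrite subr_eq0 eq_sym (negbTE ij) mulr0.
by move=> ->; apply: eq_bigr => i _; rewrite addrK.
Qed.

End CyclicExponential.

Lemma expRN_lip {R : realType} (x y : R) : 0 <= x -> x <= y ->
  0 <= expR (- x) - expR (- y) <= y - x.
Proof.
move=> x0 xy; rewrite subr_ge0 ler_expR lerN2 xy/=.
have -> : expR (- y) = expR (- x) * expR (- (y - x)).
  by rewrite -expRD; congr expR; ring.
rewrite -[X in X - _]mulr1 -mulrBr.
apply: (@le_trans _ _ (1 - expR (- (y - x)))).
  rewrite ler_piMl ?subr_ge0 ?expR_le1 ?oppr_le0//.
  by rewrite subr_ge0.
by have := expR_ge1Dx (- (y - x)); lra.
Qed.

(** * Kernels of the semigroup and their derivative at 0 *)

Section SemigroupKernel.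
Context {R : realType} (r : nat -> R).
Context (r_gt0 : forall n, 0 < r n).
Implicit Types (s t : R) (k : cycles -> R[i]).

Definition kreal t (p : cycles) : R :=
  expR (- ((rate (tag p) + r (tag p)) * t)) * cyc_exp (tagged p) (r (tag p) * t).

Definition kap t (p : cycles) : R[i] := (kreal t p)%:C.

(* the convolution kernel of r(P-1)-b, where P rotates each cycle by one state *)
Definition gen (p : cycles) : R[i] :=
  (r (tag p) * (tagged p - inZp 1 == 0)%:R
   - (rate (tag p) + r (tag p)) * (tagged p == 0)%:R)%:C.

Lemma kreal_ge0 t p : 0 <= t -> 0 <= kreal t p.
Proof. by move=> t0; rewrite mulr_ge0 ?expR_ge0 ?cyc_exp_ge0// mulr_ge0// ltW. Qed.

Lemma kap_ge0 t p : 0 <= t -> 0 <= kap t p.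
Proof. by move=> t0; rewrite ler0c kreal_ge0. Qed.

Lemma sum_kreal t n : \sum_(x < n.+1) kreal t (st x) = expR (- (rate n * t)).
Proof. by rewrite /kreal/= -mulr_sumr sum_cyc_exp -expRD/=; congr expR; ring. Qed.

Lemma block_sum_kap t n : block_sum (kap t) n = (expR (- (rate n * t)))%:C.
Proof. by rewrite -sum_kreal rmorph_sum. Qed.

Lemma block_norm_kap t n : 0 <= t -> block_norm (kap t) n = expR (- (rate n * t)).
Proof.
move=> t0; rewrite -sum_kreal; apply: eq_bigr => x _.
by rewrite normcC ger0_norm// kreal_ge0.
Qed.

Lemma block_norm_kap_le1 t n : 0 <= t -> block_norm (kap t) n <= 1.
Proof.
move=> t0; rewrite block_norm_kap// expR_le1 oppr_le0 mulr_ge0//.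
exact/ltW/rate_gt0.
Qed.

(** The first clause says that the jump is real and nonnegative, which makes the averages positive
    operations. *)
Lemma jump_kap t n : 0 <= t ->
  jump (kap t) n = (normc (jump (kap t) n))%:C /\
  normc (jump (kap t) n) <= t * rate_gap n.
Proof.
move=> t0; rewrite /jump !block_sum_kap -rmorphB normcC.
have b0 : 0 <= rate n.+1 * t by rewrite mulr_ge0// ltW// rate_gt0.
have bb : rate n.+1 * t <= rate n * t.
  by rewrite ler_wpM2r// -subr_ge0 ltW// rate_gap_gt0.
have /andP[h1 h2] := expRN_lip b0 bb.
split; first by rewrite ger0_norm.
by rewrite ger0_norm//; apply: (le_trans h2); rewrite /rate_gap; lra.
Qed.

Lemma controlled_kap t : 0 <= t -> controlled (1 + t) (kap t).
Proof.
move=> t0; split=> n.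
  by apply: (le_trans (block_norm_kap_le1 _ t0)); rewrite lerDl.
have [_ h] := jump_kap n t0; apply: (le_trans h).
by rewrite ler_wpM2r ?lerDr// ltW// rate_gap_gt0.
Qed.

Lemma kapD s t : conv (kap s) (kap t) = kap (s + t).
Proof.
apply/funext => -[n x]; rewrite convE /kap /kreal/= [r n * (s + t)]mulrDr cyc_expD.
rewrite mulr_sumr rmorph_sum/=; apply: eq_bigr => j _; rewrite -rmorphM/=.
congr (_%:C); rewrite [in RHS]mulrDr opprD expRD; ring.
Qed.

Lemma kap0 : kap 0 = unit0.
Proof.
apply/funext => -[n x]; rewrite unit0E /kap /kreal/= !mulr0 oppr0 expR0 mul1r.
by rewrite cyc_exp0 rmorph_nat.
Qed.

Lemma block_sum_gen n : block_sum gen n = (- rate n)%:C.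
Proof.
rewrite /block_sum /gen/= -rmorph_sum/=; congr (_%:C).
rewrite sumrB -!mulr_sumr.
rewrite (bigD1 (inZp 1))//= subrr eqxx big1 ?addr0; last first.
  by move=> i /negbTE i1; rewrite subr_eq0 i1.
rewrite (bigD1 0)//= ?eqxx big1; last by move=> i /negbTE ->.
by ring.
Qed.

Lemma is_derive_kreal p : is_derive (0 : R) 1 (kreal ^~ p) (complex.Re (gen p)).
Proof.
case: p => n x; rewrite /gen/=.
set c := rate n + r n.
have d1 : is_derive (0 : R) (1 : R) (fun t => - (c * t)) (- c).
  apply: is_deriveN.
  by have := is_deriveZ c (is_derive_id (0 : R) (1 : R)); rewrite /GRing.scale/= mulr1.
have d2 : is_derive (0 : R) (1 : R) (fun t => r n * t) (r n).
  by have := is_deriveZ (r n) (is_derive_id (0 : R) (1 : R)); rewrite /GRing.scale/= mulr1.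
have d3 := @is_derive1_comp _ (@expR R) _ 0 _ _ (is_derive_expR _) d1.
have d4 := @is_derive1_comp _ (cyc_exp x) _ 0 _ _ (is_derive_cyc_exp x _) d2.
have d5 : is_derive (0 : R) (1 : R) (kreal ^~ (existT _ n x)) _ := is_deriveM d3 d4.
apply: (is_derive_eq d5); rewrite /GRing.scale/= !mulr0 oppr0 expR0 !cyc_exp0.
by rewrite /c; ring.
Qed.

Lemma kap_diff p :
  normc (t^-1%:C * (kap t p - unit0 p) - gen p) @[t --> 0^'+] --> 0.
Proof.
have [dk ek] := is_derive_kreal p.
have : t^-1 *: (kreal (t *: 1 + 0) p - kreal 0 p) @[t --> 0^'] --> complex.Re (gen p).
  by rewrite -ek; exact: dk.
move=> /cvg_dnbhs_at_right h.
rewrite -kap0.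
have -> : (fun t => normc (t^-1%:C * (kap t p - kap 0 p) - gen p)) =
  (fun t => `|t^-1 *: (kreal (t *: 1 + 0) p - kreal 0 p) - complex.Re (gen p)|).
  apply/funext => t; rewrite addr0 [t *: 1]mulr1.
  by rewrite -[in RHS]normcC rmorphB [_ *: _]/(_ * _) rmorphM rmorphB.
rewrite [X in _ --> X](_ : _ = `|complex.Re (gen p) - complex.Re (gen p)|); last by rewrite subrr normr0.
apply: cvg_norm.
by apply: cvgB; [exact: h|exact: cvg_cst].
Qed.

Lemma conv_cvg0 (I : Type) (F : set_system I) (FF : Filter F)
    (k : I -> cycles -> R[i]) l p :
  (forall p, normc (k i p) @[i --> F] --> 0) ->
  normc (conv (k i) l p) @[i --> F] --> 0.
Proof.
move=> k0; case: p => n x.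
have h : \sum_(j < n.+1) normc (k i (st j)) * normc (l (st (x - j))) @[i --> F] -->
    \sum_(j < n.+1) 0 * normc (l (st (x - j))).
  apply: cvg_big => [|j _]; first by apply: add_continuous.
  by apply: cvgMl; exact: k0.
rewrite big1 in h; last by move=> j _; rewrite mul0r.
apply: (@squeeze_cvgr _ _ _ _ (fun=> 0) _ _ _ _ (cvg_cst _) h).
apply: nearW => i; rewrite normc_ge0/= convE; apply: (le_trans (normc_sum _ _ _)).
by apply: ler_sum => j _; rewrite normcM.
Qed.

Section Resolvent.
Context (lambda : R[i]) (rho : cycles -> R[i]) (C : R).
Context (rho_ctrl : controlled C rho).
Context (rho_res : conv gen rho = lambda *: rho - unit0).

Definition res_diff t := t^-1%:C *: (conv (kap t) rho - rho).

Let h := lambda *: rho - unit0.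

Lemma res_diff_cvg p : normc (res_diff t p - h p) @[t --> 0^'+] --> 0.
Proof.
rewrite /h -rho_res.
have -> : (fun t => normc (res_diff t p - conv gen rho p)) =
    (fun t => normc (conv (t^-1%:C *: (kap t - unit0) - gen) rho p)).
  by apply/funext => t; rewrite convBl convZl convBl conv_unit0.
by apply: conv_cvg0; exact: kap_diff.
Qed.

Let defect n t := block_norm (conv (kap t) rho - rho) n.

Let defectD n s t : 0 <= s -> 0 <= t -> defect n (s + t) <= defect n s + defect n t.
Proof.
move=> s0 t0; rewrite /defect.
have -> : conv (kap (s + t)) rho - rho =
    (conv (kap s) rho - rho) + conv (kap s) (conv (kap t) rho - rho).
  by rewrite convBr convA kapD [RHS]addrC addrA subrK.
apply: (le_trans (block_normD _ _ _)); rewrite lerD2l.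
apply: (le_trans (block_norm_conv _ _ _)).
by rewrite ler_piMl ?block_norm_ge0 ?block_norm_kap_le1.
Qed.

Let defectMn n t m : 0 <= t -> defect n (m%:R * t) <= m%:R * defect n t.
Proof.
move=> t0; elim: m => [|m IH].
  by rewrite !mul0r /defect kap0 conv_unit0 subrr /block_norm big1// => x _; rewrite normc0.
rewrite -natr1 !mulrDl !mul1r; apply: le_trans (defectD _ _ _) _ => //.
  by rewrite mulr_ge0.
by rewrite lerD2r.
Qed.

(** Since [kap s] contracts each block, [defect n] is subadditive in time. Hence [defect n t] is at
    most m times [defect n (t / m)], and for large m this is governed by the derivative at 0. That
    derivative is h, which does not involve the speeds explicitly, whereas a bound through the norm
    of [gen] would grow with n. *)
Let defect_le n t : 0 < t -> defect n t <= t * block_norm h n.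
Proof.
move=> t0; apply/ler_addgt0Pr => e e0.
have et : 0 < e / t by rewrite divr_gt0.
have hc : block_norm (res_diff s - h) n @[s --> 0^'+] --> 0.
  by apply: block_norm_cvg0 => p; exact: res_diff_cvg.
have /cvgrPdist_le/(_ _ et) := hc.
rewrite near_withinE => /nbhs_ballP[d /= d0 hd].
have [m /andP[m0 mt]] : exists m, (0 < m)%N && (t / m%:R < d).
  exists (Num.truncn (t / d)).+1; rewrite /= ltr_pdivrMr// mulrC -ltr_pdivrMr//.
  by rewrite truncnS_gt.
have m0' : 0 < m%:R :> R by rewrite ltr0n.
have tm : 0 < t / m%:R by rewrite divr_gt0.
have := hd (t / m%:R); rewrite /ball/= sub0r normrN gtr0_norm// => /(_ mt tm).
rewrite sub0r normrN ger0_norm ?block_norm_ge0// => hm.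
have : block_norm (res_diff (t / m%:R)) n <= block_norm h n + e / t.
  rewrite -[res_diff _](subrK h); apply: (le_trans (block_normD _ _ _)).
  by rewrite addrC lerD2l.
rewrite /res_diff block_normZ normcC gtr0_norm ?invr_gt0// ler_pdivrMl// => hr.
have e1 : defect n t <= m%:R * defect n (t / m%:R).
  by rewrite {1}(_ : t = m%:R * (t / m%:R)) ?defectMn ?ltW// mulrC divfK// gt_eqF.
apply: (le_trans e1).
have -> : t * block_norm h n + e = m%:R * (t / m%:R * (block_norm h n + e / t)).
  by field; rewrite !gt_eqF.
by rewrite ler_pM2l.
Qed.

(** The constant does not depend on t, as dominated convergence requires. Blocks are bounded by
    [defect_le], jumps by a discrete product rule. *)
Lemma controlled_res_diff t : 0 < t ->
  controlled (normc lambda * C + 1 + 2 * C) (res_diff t).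
Proof.
move=> t0; have C0 := controlled_ge0 rho_ctrl; split=> n.
  rewrite block_normZ normcC gtr0_norm ?invr_gt0// ler_pdivrMl//.
  apply: (le_trans (defect_le _ t0)); rewrite ler_pM2l//.
  apply: (le_trans (block_normB _ _ _)); rewrite block_normZ block_norm_unit0.
  rewrite -addrA lerD//; first by rewrite ler_wpM2l ?normc_ge0//; apply rho_ctrl.
  by rewrite lerDl mulr_ge0.
have -> : jump (res_diff t) n = t^-1%:C *
    (jump (kap t) n * block_sum rho n.+1 + (block_sum (kap t) n - 1) * jump rho n).
  rewrite jumpZ jumpB /jump !block_sum_conv; ring.
rewrite normcM normcC gtr0_norm ?invr_gt0// ler_pdivrMl//.
apply: (le_trans (ler_normcD _ _)); rewrite !normcM.
apply: (@le_trans _ _ (t * (2 * C * rate_gap n))).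
  have -> : t * (2 * C * rate_gap n) =
      t * rate_gap n * C + t * (C * rate_gap n) by ring.
  apply: lerD; apply: ler_pM; rewrite ?normc_ge0//.
  - by have [] := jump_kap n (ltW t0).
  - by apply: (le_trans (normc_block_sum _ _)); apply rho_ctrl.
  - rewrite block_sum_kap -[1]/(1%:C) -rmorphB normcC distrC.
    have b0 : 0 <= rate n * t by rewrite mulr_ge0 ?ltW ?rate_gt0.
    have /andP[h1 h2] := expRN_lip (lexx 0) b0.
    rewrite oppr0 expR0 in h1 h2; rewrite addr0 in h2.
    rewrite ger0_norm//; apply: (le_trans h2).
    by rewrite ler_piMl ?rate_le1 ?ltW.
  - by apply rho_ctrl.
rewrite ler_pM2l// ler_wpM2r ?(ltW (rate_gap_gt0 _))// lerDr addr_ge0//.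
by rewrite mulr_ge0 ?normc_ge0.
Qed.

End Resolvent.
End SemigroupKernel.

(** * Elementary trigonometric estimates *)

Section Trigonometry.
Context {R : realType}.
Implicit Types (a b x y : R).

Definition cis x : R[i] := cos x +i* sin x.

Lemma cisD x y : cis (x + y) = cis x * cis y.
Proof.
by rewrite /cis [RHS]/GRing.mul/= cosD sinD [sin x * _ + _]addrC.
Qed.

Lemma cis0 : cis 0 = 1.
Proof. by rewrite /cis cos0 sin0. Qed.

Lemma cisMn x n : cis (n%:R * x) = cis x ^+ n.
Proof.
elim: n => [|n IH]; first by rewrite mul0r cis0 expr0.
by rewrite -natr1 mulrDl mul1r cisD IH exprSr.
Qed.

Lemma normc_cis x : normc (cis x) = 1.
Proof. by rewrite /= cos2Dsin2 sqrtr1. Qed.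

Lemma cos_lt1 x : 0 < x < pi *+ 2 -> cos x < 1.
Proof.
move=> /andP[x0 x2].
have s0 : 0 < sin (x / 2).
  by apply: sin_gt0_pi; rewrite divr_gt0//= ltr_pdivrMr// mulr_natr.
have -> : x = (x / 2) *+ 2 by rewrite -mulr_natr divfK.
rewrite cos_mulr2n cos2sin2 mulr2n -subr_gt0.
have : 0 < sin (x / 2) ^+ 2 by rewrite exprn_gt0.
lra.
Qed.

(** Cosine decreases up to pi and increases from there to 2 pi. *)
Lemma cos_le_ends a b x : 0 <= a -> a <= x <= b -> b <= pi *+ 2 ->
  cos x <= Num.max (cos a) (cos b).
Proof.
move=> a0 /andP[ax xb] b2.
have le_cos u v : 0 <= u -> u <= v -> v <= pi -> cos v <= cos u.
  move=> u0 uv vpi; rewrite leNgt ltr_cos ?in_itv/= -?leNgt//;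
    by apply/andP; split; lra.
have refl z : cos z = cos (pi *+ 2 - z) by rewrite -[RHS]cosN opprB -[RHS]cosD2pi subrK.
rewrite le_max; have [xpi|pix] := leP x pi.
  by rewrite le_cos.
apply/orP; right; rewrite [cos x]refl [cos b]refl le_cos//; lra.
Qed.

Lemma atan_bounds y : 0 < y -> y / (1 + y ^+ 2) <= atan y <= y.
Proof.
move=> y0.
have datan z : z \in `]0, y[ -> is_derive z 1 atan (1 + z ^+ 2)^-1.
  by move=> _; exact: is_derive1_atan.
have catan : {within `[0, y], continuous atan}.
  by apply: derivable_within_continuous => z _; exact: ex_derive.
have [c] := MVT y0 datan catan.
rewrite in_itv/= => /andP[c0 cy]; rewrite atan0 !subr0 => ->.
have c1 : 1 <= 1 + c ^+ 2 by rewrite lerDl sqr_ge0.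
have c2 : 0 < 1 + c ^+ 2 by rewrite (lt_le_trans ltr01).
have y2 : 0 < 1 + y ^+ 2 by rewrite ltr_pwDl// sqr_ge0.
rewrite [y / _]mulrC ler_wpM2r ?(ltW y0)//=; last first.
  by rewrite lef_pV2 ?posrE// lerD2l ler_sqr ?nnegrE ltW.
by rewrite ler_piMl ?(ltW y0)// invf_le1.
Qed.

Lemma sin_le_id x : 0 <= x -> sin x <= x.
Proof.
move=> x0; have ds z : z \in `]0, x[ -> is_derive z 1 sin (cos z).
  by move=> _; exact: is_derive_sin.
have cs : {within `[0, x], continuous sin}.
  by apply: derivable_within_continuous => z _; exact: ex_derive.
have [c _] := MVT_segment x0 ds cs.
by rewrite sin0 !subr0 => ->; rewrite ler_piMl ?cos_le1.
Qed.

Lemma cos_ge_sqr x : 0 <= x -> 1 - cos x <= x ^+ 2.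
Proof.
move=> x0.
have -> : x = (x / 2) *+ 2 by rewrite -mulr_natr divfK.
have x2 : 0 <= x / 2 by rewrite divr_ge0.
set y := x / 2 in x2 *; rewrite cos_mulr2n cos2sin2.
have h1 : sin y ^+ 2 <= y ^+ 2.
  have [s0|s0] := leP 0 (sin y); first by rewrite ler_sqr ?nnegrE ?sin_le_id.
  rewrite -sqrrN ler_sqr ?nnegrE ?oppr_ge0 ?(ltW s0)//.
  have [yp|yp] := leP y pi.
    by have := sin_ge0_pi (introT andP (conj x2 yp)); rewrite leNgt s0.
  by apply: le_trans (ltW yp); have := sin_geN1 y; have := @pi_ge2 R; lra.
have h2 := sqr_ge0 y.
have -> : (y *+ 2) ^+ 2 = 4 * y ^+ 2 by ring.
have -> : 1 - ((1 - sin y ^+ 2) *+ 2 - 1) = 2 * sin y ^+ 2 by ring.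
by lra.
Qed.

Lemma sin_ge_lin x : 0 <= x -> x - x ^+ 3 <= sin x.
Proof.
move=> x0; have ds z : z \in `]0, x[ -> is_derive z 1 sin (cos z).
  by move=> _; exact: is_derive_sin.
have cs : {within `[0, x], continuous sin}.
  by apply: derivable_within_continuous => z _; exact: ex_derive.
have [c] := MVT_segment x0 ds cs.
rewrite in_itv/= sin0 !subr0 => /andP[c0 cx] ->.
have h : 1 - cos c <= x ^+ 2.
  by apply: (le_trans (cos_ge_sqr c0)); rewrite ler_sqr ?nnegrE.
rewrite exprSr -[X in X - _]mul1r -mulrBl ler_wpM2r//; lra.
Qed.

(** The squared modulus is 1 - 2 sigma cos phi + sigma^2, hence at least (sigma - kappa)^2 + 1 -
    kappa^2. The bound is free of sigma, so that only the angle of a power of the pole has to be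
    controlled. *)
Lemma one_sub_cis_ge (kappa sigma phi : R) : 0 <= kappa -> 0 <= sigma ->
  cos phi <= kappa ->
  Num.sqrt (1 - kappa ^+ 2) <= normc (1 - sigma%:C * cis phi).
Proof.
move=> k0 s0 ck.
have -> : 1 - sigma%:C * cis phi = (1 - sigma * cos phi) +i* (- (sigma * sin phi)).
  apply/eqP; rewrite eq_complex/=; apply/andP; split; apply/eqP; ring.
rewrite /= ler_wsqrtr// sqrrN exprMn sin2cos2.
have h1 : sigma * cos phi <= sigma * kappa by rewrite ler_wpM2l.
have h2 := sqr_ge0 (sigma - kappa); nra.
Qed.

End Trigonometry.

(** * Rotation speeds and the resolvent kernel *)

Section Speeds.
Context {R : realType}.

(* enumerates the dyadic rationals q / 2^j of [1, 2[, level j after level j *)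
Definition theta n : R := n.+1%:R / (2 ^ trunc_log 2 n.+1)%:R.

Lemma theta_bounds n : 1 <= theta n < 2.
Proof.
have /andP[h1 h2] := trunc_log_bounds (isT : (1 < 2)%N) (ltn0Sn n).
have p0 : 0 < (2 ^ trunc_log 2 n.+1)%:R :> R by rewrite ltr0n expn_gt0.
rewrite /theta ler_pdivlMr// mul1r ler_nat h1 ltr_pdivrMr//.
by rewrite -natrM ltr_nat -expnS.
Qed.

Lemma theta_dense (tau e : R) N : 1 <= tau < 2 -> 0 < e ->
  exists2 n, (N <= n)%N & `|theta n - tau| < e.
Proof.
move=> /andP[t1 t2] e0.
(* As j exceeds both N and 1/e, level j has mesh below e and its indices are at least N; [q / 2 ^ j]
   rounds tau down to that level. *)
pose j := (N + Num.truncn e^-1).+1.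
have pj : 0 < (2 ^ j)%:R :> R by rewrite ltr0n expn_gt0.
pose q := Num.truncn (tau * (2 ^ j)%:R).
have tj0 : 0 <= tau * (2 ^ j)%:R by apply: mulr_ge0; [lra|exact: ltW].
have /andP[q1 q2] := truncn_itv tj0; rewrite -/q in q1 q2.
have jq : (2 ^ j <= q)%N.
  by rewrite -ltnS -(ltr_nat R); apply: le_lt_trans q2; rewrite ler_peMl ?(ltW pj).
have qj : (q < 2 ^ j.+1)%N.
  rewrite -(ltr_nat R); apply: (le_lt_trans q1).
  by rewrite expnS natrM ltr_pM2r.
have q0 : (0 < q)%N by apply: leq_trans jq; rewrite expn_gt0.
exists q.-1.
  rewrite -ltnS prednK//; apply: leq_trans jq; apply: ltn_trans (ltn_expl j _) => //.
  by rewrite ltnS leq_addr.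
rewrite /theta prednK// (@trunc_log_eq 2 j q)//; last by rewrite jq.
have -> : q%:R / (2 ^ j)%:R - tau = (q%:R - tau * (2 ^ j)%:R) / (2 ^ j)%:R.
  by rewrite mulrBl mulfK// gt_eqF.
rewrite normrM normfV (gtr0_norm pj) ltr_pdivrMr//.
apply: (@le_lt_trans _ _ 1).
  by rewrite ler0_norm ?subr_le0//; move: q2; rewrite -natr1; lra.
rewrite -ltr_pdivrMl// mulr1.
apply: (@lt_trans _ _ j%:R); last by rewrite ltr_nat ltn_expl.
apply: (lt_le_trans (truncnS_gt _)).
by rewrite ler_nat ltnS leq_addl.
Qed.

Definition speed n : R := n.+1%:R * theta n / (pi *+ 2).

(** From 1 <= theta < 2 and 4 <= 2 pi < 8. *)
Lemma speed_bounds n : n.+1%:R / 8 <= speed n <= n.+1%:R / 2.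
Proof.
have /andP[t1 t2] := theta_bounds n; have p2 := @pi_ge2 R.
have p4 : pi < 4 :> R by have := @pihalf_lt2 R; rewrite ltr_pdivrMr//; lra.
have p0 : 0 < (pi *+ 2 : R) by lra.
have n0 : 0 < n.+1%:R :> R by [].
by rewrite /speed ler_pdivlMr// ler_pdivrMr//; apply/andP; split; nra.
Qed.

Lemma speed_gt0 n : 0 < speed n.
Proof. by have /andP[h _] := speed_bounds n; apply: lt_le_trans h. Qed.

Lemma conv_gen f n (x : 'I_n.+1) :
  conv (gen speed) f (st x) =
  (speed n)%:C * f (st (x - inZp 1)) - (rate n + speed n)%:C * f (st x).
Proof.
rewrite convE.
have e (j : 'I_n.+1) : gen speed (st j) * f (st (x - j)) =
    (speed n)%:C * ((j - inZp 1 == 0)%:R * f (st (x - j)))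
    - (rate n + speed n)%:C * ((j == 0)%:R * f (st (x - j))).
  rewrite /gen/=; move: (rate n) (speed n) => b r.
  by rewrite rmorphB !rmorphM/= !rmorph_nat; ring.
under eq_bigr do rewrite e.
rewrite sumrB -!mulr_sumr; congr (_ * _ - _ * _).
- rewrite (bigD1 (inZp 1))//= subrr eqxx mul1r big1 ?addr0// => i /negbTE i1.
  by rewrite subr_eq0 i1 mul0r.
- rewrite (bigD1 0)//= ?eqxx mul1r subr0 big1 ?addr0// => i /negbTE ->.
  by rewrite mul0r.
Qed.

Lemma val_sub1 n (x : 'I_n.+1) :
  nat_of_ord (x - inZp 1) = if x == 0 then n else x.-1.
Proof.
set y := x - inZp 1; have -> : x = y + inZp 1 by rewrite subrK.
clearbody y => {x}.
have := ltn_ord y; rewrite ltnS leq_eqVlt => /predU1P[yn|yn].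
  have -> : y + inZp 1 = 0.
    by apply: val_inj => /=; rewrite yn modnDmr addn1 modnn.
  by rewrite eqxx.
have yv : nat_of_ord (y + inZp 1) = y.+1.
  by rewrite /= modnDmr addn1 modn_small.
by rewrite ifF ?yv//; apply/eqP => y0; move: yv; rewrite y0.
Qed.

Section ResolventKernel.
Context (lambda : R[i]).

(** Chosen so that lambda + b - r (P - 1) = r (pole - P). *)
Definition pole n : R[i] := 1 + (lambda + (rate n)%:C) / (speed n)%:C.

(* the kernel of (lambda + b - r(P-1))^-1, summed as a geometric series in P *)
Definition rho (p : cycles) : R[i] :=
  let n := tag p in
  (pole n)^-1 ^+ (tagged p) /
  ((speed n)%:C * pole n * (1 - (pole n)^-1 ^+ n.+1)).

Lemma rhoE n (x : 'I_n.+1) : rho (st x) = (pole n)^-1 ^+ x /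
  ((speed n)%:C * pole n * (1 - (pole n)^-1 ^+ n.+1)).
Proof. by []. Qed.

Context (pole_neq0 : forall n, pole n != 0).
Context (poleX_neq1 : forall n, 1 - (pole n)^-1 ^+ n.+1 != 0).

Lemma conv_gen_rho : conv (gen speed) rho = lambda *: rho - unit0.
Proof.
apply/funext => -[n x]; rewrite -/(st x) conv_gen.
transitivity (lambda * rho (st x) - unit0 (st x)) => //.
rewrite unit0E !rhoE val_sub1.
have r0 : (speed n)%:C != 0 by rewrite fmorph_eq0 gt_eqF// speed_gt0.
have := pole_neq0 n; have := poleX_neq1 n.
have lE : lambda = (speed n)%:C * (pole n - 1) - (rate n)%:C.
  by rewrite /pole; field.
move: (pole n) lE => w -> D0 w0.
(* At x = 0 the shift wraps around to the last state; the factor 1 - w^-(n+1) is what closes the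
   geometric series there. *)
rewrite rmorphD/=; case: eqVneq => [->|x0] /=.
  rewrite expr0; have wn : w * w^-1 ^+ n.+1 = w^-1 ^+ n by rewrite exprS mulrA mulfV// mul1r.
  set z := w^-1 ^+ n.+1 in D0 wn *; rewrite -wn.
  by field; rewrite r0 w0 D0.
have xn : nat_of_ord x = x.-1.+1 by rewrite prednK// lt0n; apply: contra_neq x0 => ?; exact: val_inj.
move: (w^-1 ^+ n.+1) D0 => z D0.
have -> : w^-1 ^+ x = w^-1 * w^-1 ^+ x.-1 by rewrite {1}xn exprS.
by field; rewrite r0 w0 D0.
Qed.

End ResolventKernel.
End Speeds.

(** * Uniform bounds for the resolvent kernel at i s with 0 < |s| < 1 *)

Lemma atan_angle_bounds {R : realType} (S N r b : R) : 0 < S -> S < 1 -> 1 <= N ->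
  0 < b -> b <= 1 -> N / 8 <= r <= N / 2 -> N <= r * (pi *+ 2) ->
  (* Put z = S / (r + b). As r >= 1/8 and S < 1, z is at most 8, so atan z >= z / (1 + z^2) >= z /
     65; and N z >= S / 2 because r + b <= 2 N. This gives S / 130. The upper bound combines atan z
     <= z with N <= 2 pi r. *)
  S / 200 <= N * atan (S / (r + b)) <= S * (pi *+ 2).
Proof.
move=> S0 S1 N1 b0 b1 /andP[r1 r2] rN.
have N0 : 0 < N by lra.
have p0 : 0 < (pi *+ 2 : R) by rewrite mulrn_wgt0// pi_gt0.
have rb : 0 < r + b by lra.
have z0 : 0 < S / (r + b) by rewrite divr_gt0.
have z8 : S / (r + b) <= 8 by rewrite ler_pdivrMr//; lra.
have /andP[a1 a2] := atan_bounds z0.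
have h2 : S <= N * (S / (r + b)) * 2.
  have -> : N * (S / (r + b)) * 2 = S * (2 * N) / (r + b).
    by field; rewrite gt_eqF.
  by rewrite ler_pdivlMr// ler_pM2l//; lra.
have h3 : N * (S / (r + b)) <= S * (pi *+ 2).
  rewrite mulrCA ler_pM2l// ler_pdivrMr//; apply: (le_trans rN).
  by rewrite mulrC ler_pM2l// lerDl ltW.
move: (S / (r + b)) z0 z8 a1 a2 h2 h3 => z z0 z8 a1 a2 h2 h3.
apply/andP; split; last by apply: le_trans h3; rewrite ler_pM2l.
have h1 : z / 65 <= atan z.
  apply: le_trans a1; rewrite ler_pM2l// lef_pV2 ?posrE//; first by nra.
  by rewrite ltr_pwDl// sqr_ge0.
apply: (@le_trans _ _ (N * (z / 65))); last by rewrite ler_pM2l.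
by nra.
Qed.

Section ImaginaryResolvent.
Context {R : realType} (s : R).
Context (s_neq0 : s != 0).
Context (s_lt1 : `|s| < 1).

Let lambda : R[i] := 0 +i* s.

Local Notation b := (@rate R).
Local Notation r := (@speed R).
Let b0 n : 0 < b n. Proof. exact: rate_gt0. Qed.
Let b1 n : b n <= 1. Proof. exact: rate_le1. Qed.
Let r0 n : 0 < r n. Proof. exact: speed_gt0. Qed.
Let s0 : 0 < `|s|. Proof. by rewrite normr_gt0. Qed.

Let y n := s / (r n + b n).

(** The pole has real part 1 + b/r and imaginary part s/r, hence the tangent s / (r + b). *)
Lemma pole_polar n :
  pole lambda n = ((1 + b n / r n) / cos (atan (y n)))%:C * cis (atan (y n)).
Proof.
have c0 : 0 < cos (atan (y n)).
  by apply: cos_gt0_pihalf; rewrite atan_gtNpi2 atan_ltpi2.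
have := atanK (y n); rewrite /tan; move: c0.
rewrite /cis; move: (cos _) (sin _) => c d c0 dc.
have -> : d = c * y n by rewrite -dc mulrC divfK// gt_eqF.
rewrite /pole /lambda.
have rn := r0 n; have bn := b0 n.
rewrite -fmorphV; apply/eqP; rewrite eq_complex/= /y; apply/andP; split; apply/eqP;
  by field; rewrite !gt_eqF// addr_gt0.
Qed.

Lemma poleV_pow n m : exists2 sigma : R, 0 <= sigma &
  (pole lambda n)^-1 ^+ m = sigma%:C * cis (- (m%:R * atan (y n))).
Proof.
have c0 : 0 < cos (atan (y n)).
  by apply: cos_gt0_pihalf; rewrite atan_gtNpi2 atan_ltpi2.
set sg := (1 + b n / r n) / cos (atan (y n)).
have sg0 : 0 < sg by rewrite divr_gt0// addr_gt0// divr_gt0.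
have -> : (pole lambda n)^-1 = sg^-1%:C * cis (- atan (y n)).
  rewrite pole_polar -/sg.
  have sgn : sg%:C != 0 by rewrite fmorph_eq0 gt_eqF.
  have cn : cis (atan (y n)) != 0 by rewrite -normc_eq0 normc_cis oner_eq0.
  have ccn : cis (atan (y n)) * cis (- atan (y n)) = 1.
    by rewrite -cisD subrr cis0.
  apply: (mulfI (mulf_neq0 sgn cn)); rewrite mulfV ?mulf_neq0//.
  by rewrite mulrACA ccn mulr1 -rmorphM mulfV// gt_eqF.
exists (sg^-1 ^+ m); first by rewrite exprn_ge0// invr_ge0 ltW.
by rewrite exprMn rmorphXn/= -cisMn mulrN.
Qed.

Lemma cos_pole n : cos (- (n.+1%:R * atan (y n))) =
  cos (n.+1%:R * atan (`|s| / (r n + b n))).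
Proof.
rewrite cosN /y; have [sp|sn] := leP 0 s; first by rewrite ger0_norm.
by rewrite ltr0_norm// mulNr atanN mulrN cosN.
Qed.

Lemma angle_bounds n :
  `|s| / 200 <= n.+1%:R * atan (`|s| / (r n + b n)) <= `|s| * (pi *+ 2).
Proof.
apply: atan_angle_bounds => //.
- by rewrite ler1n.
- exact: speed_bounds.
- have /andP[t1 _] := @theta_bounds R n.
  rewrite /speed divfK; first by rewrite ler_peMr.
  by rewrite gt_eqF// mulrn_wgt0// pi_gt0.
Qed.

(** Up to sign, the angle of the power lies between |s| / 200 and 2 pi |s|, a compact part of ]0, 2
    pi[ independent of n because 0 < |s| < 1. There the cosine stays below some kappa < 1. *)
Lemma pole_gap : exists2 delta : R, 0 < delta &
  forall n, delta <= normc (1 - (pole lambda n)^-1 ^+ n.+1).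
Proof.
have p2 := @pi_ge2 R; have S1 := s_lt1; have S0 := s0.
pose kappa := Num.max 0 (Num.max (cos (`|s| / 200)) (cos (`|s| * (pi *+ 2)))).
have k0 : 0 <= kappa by rewrite le_max lexx.
have k1 : kappa < 1.
  rewrite !gt_max ltr01/=; apply/andP; split; apply: cos_lt1.
    have h : `|s| < pi *+ 2 * 200 by lra.
    by rewrite divr_gt0//= ltr_pdivrMr.
  have p0 : 0 < (pi *+ 2 : R) by lra.
  by rewrite mulr_gt0//= gtr_pMl.
exists (Num.sqrt (1 - kappa ^+ 2)).
  by rewrite sqrtr_gt0 subr_gt0 expr_lt1.
move=> n; have [sg sg0 ->] := poleV_pow n n.+1.
apply: one_sub_cis_ge => //; rewrite cos_pole le_max.
apply/orP; right; apply: cos_le_ends (angle_bounds n) _; first by lra.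
by rewrite ler_piMl ?ltW// mulrn_wgt0// pi_gt0.
Qed.

Lemma normc_pole_ge1 n : 1 <= normc (pole lambda n).
Proof.
apply: le_trans (ler_Re_normc _); rewrite /pole -fmorphV/=.
have bn := b0 n; have rn := r0 n.
rewrite ger0_norm; rewrite ?(mulr0, oppr0, mul0r, subr0, add0r, addr0).
  by rewrite lerDl divr_ge0// ltW.
by rewrite addr_ge0// divr_ge0// ltW.
Qed.

Lemma pole_neq0 n : pole lambda n != 0.
Proof. by rewrite -normc_gt0 (lt_le_trans ltr01 (normc_pole_ge1 n)). Qed.

Lemma poleX_neq1 n : 1 - (pole lambda n)^-1 ^+ n.+1 != 0.
Proof.
have [delta d0 dn] := pole_gap.
by rewrite -normc_gt0 (lt_le_trans d0).
Qed.

Lemma conv_gen_rho_im : conv (gen r) (rho lambda) = lambda *: rho lambda - unit0.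
Proof. exact: conv_gen_rho pole_neq0 poleX_neq1. Qed.

Lemma normc_lambda_rate n : `|s| <= normc (lambda + (b n)%:C).
Proof. by apply: le_trans (ler_Im_normc _); rewrite /= addr0. Qed.

(** Summing the resolvent equation over a block eliminates the rotation. *)
Lemma block_sum_rho n : block_sum (rho lambda) n = (lambda + (b n)%:C)^-1.
Proof.
have := congr1 (fun f => block_sum f n) conv_gen_rho_im.
rewrite block_sum_conv block_sum_gen block_sumB block_sumZ block_sum_unit0 => h.
have l0 : lambda + (b n)%:C != 0.
  by rewrite -normc_gt0 (lt_le_trans s0 (normc_lambda_rate n)).
apply: (mulfI l0); rewrite mulfV// mulrDl.
by move: h; rewrite rmorphN/= mulNr => /eqP; rewrite -subr_eq0 opprB addrA => /eqP;
  move: (_ * _) (_ * _) => u v h; apply/eqP; rewrite -subr_eq0 -oppr_eq0 -h; apply/eqP; ring.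
Qed.

Lemma controlled_rho : exists C, controlled C (rho lambda).
Proof.
have [delta d0 dn] := pole_gap.
(* The first summand bounds the blocks: n+1 entries of modulus at most 1 / (r_n delta), with r_n >=
   (n+1) / 8. The second bounds the jumps: the difference of two inverses has numerator [rate_gap n]
   and a denominator of modulus at least |s|^2. *)
exists (8 / delta + (`|s| ^+ 2)^-1); split=> n.
  apply: (@le_trans _ _ (8 / delta)); last first.
    by rewrite lerDl invr_ge0 exprn_ge0.
  have rn := r0 n; have /andP[r1 _] := @speed_bounds R n.
  apply: (@le_trans _ _ (\sum_(x < n.+1) (r n * delta)^-1)); last first.
    rewrite sumr_const card_ord -[_ *+ n.+1]mulr_natl invfM mulrA ler_pM2r ?invr_gt0//.
    by rewrite ler_pdivrMr//; lra.
  apply: ler_sum => x _; rewrite rhoE normcM normcV !normcM normcC (gtr0_norm rn).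
  rewrite normcX normcV; have w1 := normc_pole_ge1 n.
  have w0 : 0 < normc (pole lambda n) by apply: lt_le_trans w1.
  apply: (@le_trans _ _ (1 * (r n * 1 * delta)^-1)); last by rewrite mul1r mulr1.
  apply: ler_pM.
  - by rewrite exprn_ge0// invr_ge0 ltW.
  - by rewrite invr_ge0 mulr_ge0 ?normc_ge0// mulr_ge0 ?normc_ge0// ltW.
  - by apply: exprn_ile1; rewrite ?invr_ge0 ?(ltW w0)// invf_le1.
  - have D0 := lt_le_trans d0 (dn n).
    have rw : 0 < r n * normc (pole lambda n) by rewrite mulr_gt0.
    rewrite lef_pV2 ?posrE; [|exact: mulr_gt0|by rewrite mulr1 mulr_gt0].
    apply: ler_pM => //; [by rewrite mulr1 ltW|exact: ltW|by rewrite ler_pM2l].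
apply: (@le_trans _ _ ((`|s| ^+ 2)^-1 * rate_gap n)); last first.
  rewrite ler_wpM2r ?(ltW (rate_gap_gt0 _))// lerDr divr_ge0//.
  exact: ltW.
rewrite /jump !block_sum_rho.
have l0 m : lambda + (b m)%:C != 0.
  by rewrite -normc_gt0 (lt_le_trans s0 (normc_lambda_rate m)).
have -> : (lambda + (b n.+1)%:C)^-1 - (lambda + (b n)%:C)^-1 =
    (rate_gap n)%:C / ((lambda + (b n.+1)%:C) * (lambda + (b n)%:C)).
  rewrite /rate_gap rmorphB/=.
  by field; rewrite !l0.
rewrite normcM normcV normcC gtr0_norm ?rate_gap_gt0// mulrC.
rewrite ler_pM2r ?rate_gap_gt0// normcM lef_pV2 ?posrE ?exprn_gt0 ?mulr_gt0 ?normc_gt0//.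
by rewrite expr2 ler_pM// normc_lambda_rate.
Qed.

End ImaginaryResolvent.

(** * Bounded operators given by controlled kernels *)

Section Operators.
Context {R : realType}.
Local Notation E := (cL1 (cmu R)).
Implicit Types (k l : cycles -> R[i]) (u v : E).

(** The norm of [E] takes its values in R[i]; this reduces convergence to real epsilons. *)
Lemma cvg_l1norm {I : Type} (F : set_system I) {FF : Filter F} (f : I -> E) u :
  (forall e, 0 < e -> \forall i \near F, l1norm (ev (f i - u)) <= e) ->
  f i @[i --> F] --> u.
Proof.
move=> h; apply/cvgrPdist_le => e e0.
have eE : e = (normc e)%:C by apply: ge0_normc; exact: ltW.
have e1 : 0 < normc e by rewrite normc_gt0 gt_eqF.
apply: filterS (h _ e1) => i hi.
by rewrite distrC norm_ev eE lecR.
Qed.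

Lemma l1norm_cvg {I : Type} (F : set_system I) {FF : Filter F} (f : I -> E) u :
  f i @[i --> F] --> u ->
  forall e, 0 < e -> \forall i \near F, l1norm (ev (f i - u)) <= e.
Proof.
move=> /cvgrPdist_le h e e0; have e1 : 0 < e%:C by rewrite ltcR.
by apply: filterS (h _ e1) => i; rewrite distrC norm_ev lecR.
Qed.

Definition op k u : E := mk (mult k (ev u)).

Lemma ev_op C k u : controlled C k -> ev (op k u) = mult k (ev u).
Proof. by move=> kC; apply: mkK; have [] := mult_le kC (ev_summing u). Qed.

Lemma l1norm_op C k u : controlled C k ->
  l1norm (ev (op k u)) <= (2 * C) * l1norm (ev u).
Proof. by move=> kC; rewrite (ev_op _ kC); have [] := mult_le kC (ev_summing u). Qed.

Lemma evDZ a u v : ev (a *: u + v) = a *: ev u + ev v.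
Proof. by apply/funext => p; rewrite evD evZ. Qed.

Lemma op_linear C k : controlled C k -> linear (op k).
Proof.
move=> kC a u v; apply: ev_inj.
by rewrite evDZ !(ev_op _ kC) evDZ (mult_linear _ kC)//; exact: ev_summing.
Qed.

Lemma opB C k u v : controlled C k -> op k (u - v) = op k u - op k v.
Proof.
move=> kC; rewrite [u - v]addrC -scaleN1r (op_linear kC) scaleN1r.
by rewrite addrC.
Qed.

Lemma opZ C k a u : controlled C k -> op k (a *: u) = a *: op k u.
Proof.
move=> kC; rewrite -[a *: u]addr0 (op_linear kC) -[X in _ + op k X](subrr u).
by rewrite (opB _ _ kC) subrr addr0.
Qed.

Lemma op_continuous C k : controlled C k -> continuous (op k).
Proof.
move=> kC u; apply: (@cvg_l1norm _ (nbhs u) (nbhs_filter u)) => e e0.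
have C0 := controlled_ge0 kC.
(* The [+ 1] keeps the denominator positive when C = 0. *)
have d0 : 0 < e / (2 * C + 1) by rewrite divr_gt0// ltr_wpDl// mulr_ge0.
have hu : (v : E) @[v --> u] --> u by exact: cvg_id.
have hh := l1norm_cvg hu d0.
apply: (@filterS _ (nbhs u) (nbhs_filter u) _ _ _ (hh _)) => v /= hv.
rewrite -/(op k v).
rewrite -(opB _ _ kC); apply: (le_trans (l1norm_op _ kC)).
apply: (@le_trans _ _ ((2 * C) * (e / (2 * C + 1)))).
  by rewrite ler_wpM2l// mulr_ge0.
rewrite mulrCA; apply: ler_piMr; first exact: ltW.
by rewrite ler_pdivrMr ?mul1r ?lerDl// ltr_wpDl// mulr_ge0.
Qed.

Lemma op_conv C D k l u : controlled C k -> controlled D l ->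
  op k (op l u) = op (conv k l) u.
Proof.
move=> kC lD; apply: ev_inj.
rewrite (ev_op _ kC) (ev_op _ lD) (ev_op _ (controlled_conv kC lD)).
by rewrite (mult_conv kC lD)//; exact: ev_summing.
Qed.

Lemma op_unit0 u : op unit0 u = u.
Proof. by rewrite /op mult_unit0 evK. Qed.

Lemma op_lin_ker C D a k l u : controlled C k -> controlled D l ->
  op (a *: k - l) u = a *: op k u - op l u.
Proof.
move=> kC lD; apply: ev_inj.
apply/funext => p; rewrite evB evZ (ev_op _ kC) (ev_op _ lD).
rewrite (ev_op _ (controlledB (controlledZ a kC) lD)).
by rewrite (mult_lin_ker a kC lD)//; exact: ev_summing.
Qed.

Lemma opB_ker C D k l u : controlled C k -> controlled D l ->
  op (k - l) u = op k u - op l u.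
Proof.
by move=> kC lD; rewrite -[k]scale1r (op_lin_ker _ _ kC lD) !scale1r.
Qed.

Lemma opZ_ker C a k u : controlled C k -> op (a *: k) u = a *: op k u.
Proof.
(* [k - k] serves as a controlled zero kernel. *)
move=> kC; have zC := controlledB kC kC.
rewrite -[a *: k]subr0 -(subrr k) (op_lin_ker _ _ kC zC) (opB_ker _ kC kC).
by rewrite subrr subr0.
Qed.

Lemma controlled_le C D k : C <= D -> controlled C k -> controlled D k.
Proof.
move=> CD [h1 h2]; split=> n; first exact: le_trans (h1 n) CD.
by apply: (le_trans (h2 n)); rewrite ler_wpM2r// ltW// rate_gap_gt0.
Qed.

Lemma op_cvg {I : Type} (F : set_system I) {FF : Filter F} C D
    (k : I -> cycles -> R[i]) l u :
  (\forall i \near F, controlled C (k i)) -> controlled D l ->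
  (forall p, normc (k i p - l p) @[i --> F] --> 0) ->
  op (k i) u @[i --> F] --> op l u.
Proof.
move=> kC lD kl; apply: (@cvg_l1norm _ F FF) => e e0.
have kC' : \forall i \near F, controlled (C + D) (k i - l).
  by apply: filterS kC => i ki; exact: controlledB.
have h : \forall i \near F, summing (mult (k i - l) (ev u)) /\
    l1norm (mult (k i - l) (ev u)) <= e.
  exact: mult_cvg0 kC' kl (ev_summing u) e0.
apply: (@filterS2 _ F FF _ _ _ _ h kC) => i [_ hi] ki.
by rewrite -(opB_ker _ ki lD) (ev_op _ (controlledB ki lD)).
Qed.

End Operators.

(** * The semigroup: continuity, conservation of mass, irreducibility *)

Section Semigroup.
Context {R : realType}.
Local Notation E := (cL1 (cmu R)).
Local Notation kap := (kap (@speed R)).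
Implicit Types (u v : E) (f : cycles -> R[i]).

Let speed0 := @speed_gt0 R.

Definition rotor (t : R) : E -> E := op (kap t).

Lemma ev_rotor t u : 0 <= t -> ev (rotor t u) = mult (kap t) (ev u).
Proof. by move=> t0; exact: ev_op (controlled_kap speed0 t0). Qed.

Lemma continuous_kap (t : R) p : normc (kap s p - kap t p) @[s --> t] --> 0.
Proof.
case: p => n x.
have -> : (fun s => normc (kap s (existT _ n x) - kap t (existT _ n x))) =
    (fun s => `|kreal (@speed R) s (existT _ n x) - kreal (@speed R) t (existT _ n x)|).
  by apply/funext => s; rewrite /kap -rmorphB normcC.
rewrite [X in _ --> X](_ : _ = `|kreal (@speed R) t (existT _ n x) -
  kreal (@speed R) t (existT _ n x)|); last by rewrite subrr normr0.
apply: cvg_norm; apply: cvgB; last exact: cvg_cst.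
have d1 (a : R) : {for t, continuous (fun s : R => a * s)}.
  by apply: cvgM; [exact: cvg_cst|exact: cvg_id].
rewrite /kreal/=; apply: cvgM.
  apply: (@continuous_comp _ _ _ (fun s => - ((rate n + speed n) * s)) (@expR R)).
    by apply: continuousN; exact: d1.
  exact: continuous_expR.
apply: (@continuous_comp _ _ _ (fun s => speed n * s) (cyc_exp x)); first exact: d1.
apply/differentiable_continuous/derivable1_diffP.
by have [] := is_derive_cyc_exp x (speed n * t).
Qed.

Lemma rotor_C0 : C0_semigroup rotor.
Proof.
split=> [t t0|f|s t f s0 t0|f].
- have kC := controlled_kap speed0 t0.
  by split; [exact: op_linear kC|exact: op_continuous kC].
- by rewrite /rotor kap0 op_unit0.
- rewrite /rotor (op_conv _ (controlled_kap speed0 s0) (controlled_kap speed0 t0)).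
  by rewrite kapD.
apply/subspace_continuousP => t; rewrite /= in_itv/= andbT => t0.
(* The control 1 + s of [kap s] grows with s, but is at most 3 + t for s < t + 1. *)
apply: (@op_cvg _ _ _ _ (3 + t) (1 + t)).
- have t1 : t < t + 1 by rewrite ltrDl.
  rewrite near_withinE; near=> s; rewrite /= in_itv/= andbT => s0.
  apply: controlled_le (controlled_kap speed0 s0).
  have : s < t + 1 by near: s; exact: lt_nbhsl.
  lra.
- exact: controlled_kap.
- by move=> p; apply: cvg_within_filter; exact: continuous_kap.
Unshelve. all: by end_near. Qed.

Lemma jump_kap_ge0 t n : 0 <= t -> 0 <= jump (kap t) n.
Proof. by move=> t0; have [-> _] := jump_kap (@speed R) n t0; rewrite ler0c normc_ge0. Qed.

Lemma psum_ge0 f n : (forall p, 0 <= f p) -> 0 <= psum f n.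
Proof. by move=> f0; apply: sumr_ge0 => j _; apply: sumr_ge0. Qed.

Lemma coupling_ge0 t f n : 0 <= t -> (forall p, 0 <= f p) ->
  0 <= coupling (kap t) f n.
Proof.
move=> t0 f0; rewrite mulr_ge0 ?jump_kap_ge0// divr_ge0 ?psum_ge0//.
by rewrite ler0c vol_ge0.
Qed.

Lemma conv_kap_ge0 t f p : 0 <= t -> (forall p, 0 <= f p) -> 0 <= conv (kap t) f p.
Proof.
by move=> t0 f0; apply: sumr_ge0 => j _; rewrite mulr_ge0// kap_ge0.
Qed.

Lemma mult_kap_ge0 t f p : 0 <= t -> summing f -> (forall p, 0 <= f p) ->
  0 <= mult (kap t) f p.
Proof.
move=> t0 sf f0; rewrite addr_ge0 ?conv_kap_ge0// tail_ge0//.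
  exact: coupling_summable (controlled_kap speed0 t0) sf.
by move=> k; exact: coupling_ge0.
Qed.

Lemma psum_l1 f n : (forall p, 0 <= f p) ->
  psum f n = (series (block_norm f) n.+1)%:C.
Proof.
move=> f0; rewrite /series/= big_mkord rmorph_sum/=.
by apply: eq_bigr => j _; rewrite ge0_block_norm.
Qed.

(** The gaps from index n on sum to at most [rate n], and [vol n.+1] is at most the later
    denominators. So the mass sent into the first n+1 cycles by the levels from n on vanishes as n
    grows. *)
Lemma vol_tail C k f n : controlled C k -> summing f ->
  normc ((vol n.+1)%:C * tail (coupling k f) n) <= C * l1norm f * rate n.
Proof.
move=> kC sf; have v0 := @volS_gt0 R n; have C0 := controlled_ge0 kC.
rewrite normcM normcC gtr0_norm// mulrC -ler_pdivlMr//.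
apply: tail_bound; last exact: coupling_summable kC sf.
move=> N nN; apply: (@le_trans _ _
    (\sum_(n <= k0 < N) C * l1norm f / vol n.+1 * rate_gap k0)).
  apply: ler_sum_nat => j /andP[nj _].
  rewrite normc_coupling.
  have -> : C * l1norm f / vol n.+1 * rate_gap j =
      (C * rate_gap j * l1norm f) / vol n.+1 by ring.
  apply: ler_pM.
  - by rewrite mulr_ge0 ?normc_ge0.
  - by rewrite invr_ge0 vol_ge0.
  - by apply: ler_pM; rewrite ?normc_ge0//; [apply kC|exact: psum_le].
  - by rewrite lef_pV2 ?posrE ?volS_gt0// vol_le.
rewrite -mulr_sumr mulrAC ler_pM2r ?invr_gt0//.
rewrite ler_wpM2l ?mulr_ge0 ?l1norm_ge0//.
have -> : \sum_(n <= k0 < N) rate_gap k0 = rate n - rate N :> R.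
  rewrite -(subnKC nN); elim: (N - n)%N => [|j IH].
    by rewrite addn0 big_geq// subrr.
  by rewrite addnS big_nat_recr ?leq_addr//= IH /rate_gap addrA subrK.
by rewrite gerBl ltW// rate_gt0.
Qed.

(** Conservation of mass in quantitative form: the bound tends to 0 with [rate n]. It covers complex
    f, as needed again to place 0 in the spectrum. *)
Lemma mass_defect t f n : 0 <= t -> summing f ->
  normc (psum (mult (kap t) f) n - psum f n) <= (1 + 2 * t) * l1norm f * rate n.
Proof.
move=> t0 sf; have kC := controlled_kap speed0 t0.
rewrite (psum_mult n kC sf) block_sum_kap.
have -> : (expR (- (rate n * t)))%:C * psum f n +
    (vol n.+1)%:C * tail (coupling (kap t) f) n - psum f n =
    ((vol n.+1)%:C * tail (coupling (kap t) f) n)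
    - (1 - expR (- (rate n * t)))%:C * psum f n by rewrite rmorphB/=; ring.
apply: (le_trans (ler_normcD _ _)); rewrite normcN [X in _ + X]normcM normcC.
have r0 := @rate_gt0 R n.
have b0 : 0 <= rate n * t by rewrite mulr_ge0// ltW.
have /andP[h1 h2] := expRN_lip (lexx 0) b0.
rewrite oppr0 expR0 in h1 h2; rewrite addr0 in h2.
have -> : (1 + 2 * t) * l1norm f * rate n =
    (1 + t) * l1norm f * rate n + rate n * t * l1norm f by ring.
apply: lerD; first exact: vol_tail.
by apply: ler_pM; rewrite ?normr_ge0 ?normc_ge0 ?psum_le// ger0_norm.
Qed.

Lemma cvg_rate : (@rate R) @ \oo --> 0.
Proof. exact: cvg_harmonic. Qed.

Lemma rotor_stochastic : stochastic_semigroup rotor.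
Proof.
move=> t u t0 /cL1_ge0P u0; have kC := controlled_kap speed0 t0.
have su := ev_summing u.
have Tu0 p : 0 <= ev (rotor t u) p by rewrite ev_rotor// mult_kap_ge0.
split; first exact/cL1_ge0P.
rewrite !norm_ev; congr (_%:C).
suff : series (block_norm (ev (rotor t u))) n.+1 - series (block_norm (ev u)) n.+1
    @[n --> \oo] --> 0.
  move=> h; apply/eqP; rewrite -subr_eq0; apply/eqP.
  rewrite -(cvg_lim (@Rhausdorff R) h); apply/esym/cvg_lim => //.
  have hs f : summing f ->
      (fun n => series (block_norm f) n.+1) @ \oo --> l1norm f.
    by move=> /summing_cvg; rewrite -(cvg_shiftS (series (block_norm f))).
  by apply: cvgB; apply: hs => //; exact: ev_summing.
apply: norm_cvg0; apply: (@squeeze_cvgr _ _ _ _ (fun=> 0)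
  (fun n => (1 + 2 * t) * l1norm (ev u) * rate n)).
- apply: nearW => n; apply/andP; split; first exact: normr_ge0.
  rewrite [leLHS](_ : _ = normc (psum (ev (rotor t u)) n - psum (ev u) n)).
    by rewrite ev_rotor//; exact: mass_defect.
  by rewrite !psum_l1// -rmorphB normcC.
- exact: cvg_cst.
- rewrite -[X in _ --> X](mulr0 ((1 + 2 * t) * l1norm (ev u))).
  by apply: cvgM; [exact: cvg_cst|exact: cvg_rate].
Qed.

(** At level k, the larger of the two cycle indices, averaging carries mass from q to p with a
    positive weight; all other contributions are nonnegative. *)
Lemma rotor_gt0 u p : (forall q, 0 <= ev u q) -> u != 0 -> 0 < ev (rotor 1 u) p.
Proof.
move=> u0 un0.
have [q uq] : exists q, ev u q != 0.
  apply: contrapT => h; move/eqP: un0; apply; apply: ev_inj; apply/funext => q.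
  by rewrite ev0; apply/eqP/negPn/negP => hq; apply: h; exists q.
have su := ev_summing u.
pose k := maxn (tag p) (tag q).
rewrite (ev_rotor _ ler01) /mult ltr_wpDl ?conv_kap_ge0//.
have ck := coupling_summable (controlled_kap speed0 ler01) su.
apply: lt_le_trans (tail_ge_term ck _ (leq_maxl _ _ : (tag p <= k)%N)); last first.
  by move=> j; exact: coupling_ge0.
rewrite mulr_gt0//.
  rewrite /jump !block_sum_kap -rmorphB ltcR !mulr1 subr_gt0 ltr_expR ltrN2.
  by rewrite -subr_gt0 rate_gap_gt0.
rewrite divr_gt0//; last by rewrite ltcR volS_gt0.
rewrite lt0r psum_ge0// andbT psum_l1// fmorph_eq0 gt_eqF//.
have bq : 0 < block_norm (ev u) (tag q).
  case: q uq @k {ck} => n x uq _; rewrite /block_norm (bigD1 x)// ltr_wpDr//.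
    by apply: sumr_ge0 => i _; exact: normc_ge0.
  by rewrite normc_gt0.
apply: (lt_le_trans bq).
have qk : (tag q < k.+1)%N by rewrite ltnS leq_maxr.
rewrite /series/= big_mkord (bigD1 (Ordinal qk))//= lerDl.
by apply: sumr_ge0 => i _; exact: block_norm_ge0.
Qed.

Definition trunc N f : cycles -> R[i] := fun p => if (tag p < N)%N then f p else 0.

Lemma block_norm_trunc N f n :
  block_norm (trunc N f) n = if (n < N)%N then block_norm f n else 0.
Proof.
rewrite /block_norm /trunc/=; case: ifP => // _.
by apply: big1 => x _; rewrite normc0.
Qed.

Lemma summing_trunc N f : summing f -> summing (trunc N f).
Proof.
move=> [B fB]; exists B => M; apply: le_trans (fB M); apply: ler_sum => n _.
by rewrite block_norm_trunc; case: ifP => // _; exact: block_norm_ge0.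
Qed.

Lemma cvg_trunc u : mk (trunc N (ev u)) @[N --> \oo] --> u.
Proof.
have su := ev_summing u.
apply: cvg_l1norm => e e0.
have /cvgrPdist_le/(_ _ e0) := summing_cvg su.
apply: filterS => N hN.
have -> : ev (mk (trunc N (ev u)) - u) = trunc N (ev u) - ev u.
  by apply/funext => p; rewrite evB mkK//; exact: summing_trunc.
apply: (proj2 (l1norm_le _)) => M.
apply: le_trans hN; apply: le_trans (ler_norm _); rewrite lerBrDl.
apply: (@le_trans _ _ (\sum_(n < maxn N M) block_norm (ev u) n)); last exact: l1norm_ub.
rewrite -!(big_mkord xpredT (fun n => block_norm _ n)).
rewrite [leRHS](@big_cat_nat _ _ _ N)//= ?leq_maxl// /series/= lerD2l.
apply: (@le_trans _ _ (\sum_(0 <= n < maxn N M) block_norm (trunc N (ev u) - ev u) n)).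
  rewrite [leRHS](@big_cat_nat _ _ _ M)//= ?leq_maxr// lerDl.
  by apply: sumr_ge0 => i _; exact: block_norm_ge0.
rewrite (@big_cat_nat _ _ _ N)//= ?leq_maxl//.
rewrite big_nat_cond big1 ?add0r; last first.
  move=> n /andP[/andP[_ nN] _]; rewrite /block_norm big1// => x _.
  transitivity (normc (trunc N (ev u) (st x) - ev u (st x))) => //.
  by rewrite /trunc/= nN subrr normc0.
apply: ler_sum_nat => n /andP[Nn _]; rewrite /block_norm; apply: ler_sum => x _.
apply: (@le_trans _ _ (normc (trunc N (ev u) (st x) - ev u (st x)))) => //.
by rewrite /trunc/= ltnNge Nn/= sub0r normcN.
Qed.

(** A nonzero invariant ideal contains the image at time 1 of the modulus of a nonzero element,
    which is positive at every state. Multiples of it dominate all functions with finitely many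
    nonzero values, and these are dense. *)
Lemma rotor_irreducible : irreducible_semigroup rotor.
Proof.
split; first by move=> t u t0 u0; have [] := rotor_stochastic t0 u0.
move=> I [I0 Ilin Isol] Icl Iinv.
have [[u [Iu un0]]|h] := pselect (exists u, I u /\ u <> 0); last first.
  left; apply/seteqP; split=> [u Iu|_ ->//].
  by apply: contrapT => un0; apply: h; exists u.
right; apply/seteqP; split=> // g _.
pose a : E := mk (fun p => (normc (ev u p))%:C).
have ev_a : ev a = (fun p => (normc (ev u p))%:C).
  apply: mkK; have [B uB] := ev_summing u; exists B => N.
  apply: le_trans (uB N); apply: ler_sum => n _; apply: ler_sum => x _.
  by rewrite normcC ger0_norm ?normc_ge0.
have a0 p : 0 <= ev a p by rewrite ev_a ler0c normc_ge0.
have an0 : a != 0.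
  apply/eqP => a_0; apply: un0; apply: ev_inj; apply/funext => p; rewrite ev0.
  apply/eqP; rewrite -normc_eq0; apply/eqP.
  by have : ev a p = 0; [rewrite a_0 ev0|rewrite ev_a => -[]].
have Ia : I a.
  apply: Isol Iu _; apply/cL1_le_absP => p.
  by rewrite ev_a normcC ger0_norm ?normc_ge0.
have Ih := Iinv _ _ ler01 Ia; set h := rotor 1 a in Ih.
have h0 p : 0 < ev h p by exact: rotor_gt0.
have nh p : 0 < normc (ev h p) by rewrite normc_gt0 gt_eqF.
apply: (closed_cvg _ Icl _ _ (@cvg_trunc g)); apply: nearW => N /=.
(* The sum of the finitely many ratios is a convenient upper bound for each of them. *)
pose C := \sum_(n < N) \sum_(x < n.+1) normc (ev g (st x)) / normc (ev h (st x)).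
have Ch : I (C%:C *: h) by rewrite -[_ *: _]addr0; exact: Ilin.
apply: Isol Ch _; apply/cL1_le_absP => p.
rewrite mkK ?evZ; last exact/summing_trunc/ev_summing.
have C0 : 0 <= C.
  by do 2 (apply: sumr_ge0 => ? _); rewrite divr_ge0 ?normc_ge0.
rewrite normcM normcC ger0_norm// /trunc; case: ifP => pN; last first.
  by rewrite normc0 mulr_ge0 ?normc_ge0.
rewrite -ler_pdivrMr//; case: p pN => n x /= nN.
rewrite /C (bigD1 (Ordinal nN))//= (bigD1 x)//= -addrA lerDl addr_ge0//.
  by apply: sumr_ge0 => ? _; rewrite divr_ge0 ?normc_ge0.
by do 2 (apply: sumr_ge0 => ? _); rewrite divr_ge0 ?normc_ge0.
Qed.

End Semigroup.

(** * The generator: resolvents and approximate eigenvectors *)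

Section Spectrum.
Context {R : realType}.
Local Notation E := (cL1 (cmu R)).
Local Notation kap := (kap (@speed R)).
Local Notation gen := (gen (@speed R)).
Local Notation T := (@rotor R).
Implicit Types (u v : E) (f : cycles -> R[i]).

Let speed0 := @speed_gt0 R.

Lemma generatorE u v : diff_quotient T u h @[h --> 0^'+] --> v ->
  generator_dom T u /\ generator T u = v.
Proof.
move=> h; split; first by apply/cvg_ex; exists v.
by apply/cvg_lim => //; exact: norm_hausdorff.
Qed.

Lemma generator_domP u : generator_dom T u ->
  diff_quotient T u h @[h --> 0^'+] --> generator T u.
Proof. by []. Qed.

Section Resolvent.
Context (lambda : R[i]) (k : cycles -> R[i]) (C : R).
Context (kC : controlled C k).
Context (k_res : conv gen k = lambda *: k - unit0).

(** The difference quotient at [op k g] is [op (res_diff _ k h) g]: its kernels are controlled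
    uniformly in h and converge entrywise, so the limit exists for every g. *)
Lemma generator_op g : diff_quotient T (op k g) h @[h --> 0^'+] -->
  lambda *: op k g - g.
Proof.
have -> : lambda *: op k g - g = op (lambda *: k - unit0) g.
  by rewrite (op_lin_ker _ _ kC controlled_unit0) op_unit0.
have e (h : R) : 0 < h -> diff_quotient T (op k g) h = op (res_diff (@speed R) k h) g.
  move=> h0; have hC := controlled_kap speed0 (ltW h0).
  rewrite /res_diff (opZ_ker _ _ (controlledB (controlled_conv hC kC) kC)).
  by rewrite (opB_ker _ (controlled_conv hC kC) kC) -(op_conv _ hC kC).
apply: (@cvg_trans _ (op (res_diff (@speed R) k h) g @[h --> 0^'+])).
  by apply: near_eq_cvg; near=> h; rewrite e.
apply: op_cvg.
- by near=> h; apply: (controlled_res_diff speed0 kC k_res).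
- exact: controlledB (controlledZ lambda kC) controlled_unit0.
- exact: res_diff_cvg.
Unshelve. all: by end_near. Qed.

Lemma resolvent_op : resolvent_set (generator_dom T) (generator T) lambda.
Proof.
exists (op k); split.
- exact: op_linear kC.
- exact: op_continuous kC.
- move=> g; have [dg ->] := generatorE (@generator_op g).
  by split=> //; rewrite opprB addrC subrK.
- move=> f /generator_domP df.
  have [_ e1] := generatorE (@generator_op f).
  (* [op k] commutes with the semigroup, hence with the generator on its domain; the left inverse
     property then follows from the right one. *)
  have h1 : diff_quotient T (op k f) h @[h --> 0^'+] --> op k (generator T f).
    apply: (@cvg_trans _ (op k (diff_quotient T f h) @[h --> 0^'+])); last first.
      exact: (continuous_cvg _ (@op_continuous _ _ _ kC (generator T f)) df).
    apply: near_eq_cvg; near=> h.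
    have h0 : 0 <= h by rewrite ltW.
    have hC := controlled_kap speed0 h0.
    rewrite /diff_quotient (opZ _ _ kC) (opB _ _ kC) /rotor.
    by rewrite (op_conv _ hC kC) (op_conv _ kC hC) convC.
  have [_ e2] := generatorE h1.
  rewrite (opB _ _ kC) (opZ _ _ kC) -e2 e1.
  by rewrite opprB addrC subrK.
Unshelve. all: by end_near. Qed.

End Resolvent.

(** A continuous inverse would send vectors arbitrarily close to 0 to vectors of norm 1. *)
Lemma approx_eigenvalue lambda :
  (forall e : R, 0 < e -> exists u, [/\ generator_dom T u, l1norm (ev u) = 1 &
     l1norm (ev (lambda *: u - generator T u)) <= e]) ->
  spectrum (generator_dom T) (generator T) lambda.
Proof.
move=> happ [S [Slin Scont _ SK]].
have S0 : S 0 = 0.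
  by have := Slin (-1) 0 0; rewrite scaler0 addr0 scaleN1r addNr.
have Sc : S v @[v --> (0 : E)] --> (0 : E) by rewrite -[X in _ --> X]S0; exact: Scont.
have half0 : 0 < 2^-1 :> R by [].
have hS : \forall v \near (0 : E), l1norm (ev (S v - 0)) <= 2^-1.
  exact: l1norm_cvg Sc _ half0.
have /nbhs_ballP[d /= d0 hd] := hS.
have dE : d = (normc d)%:C by apply: ge0_normc; exact: ltW.
have d1 : 0 < normc d / 2 by rewrite divr_gt0// normc_gt0 gt_eqF.
have [u [du u1 ue]] := happ _ d1.
have := hd (lambda *: u - generator T u).
rewrite /= SK// subr0 u1 -ball_normE /ball_/= sub0r normrN norm_ev dE ltcR.
have -> : l1norm (ev (lambda *: u - generator T u)) < normc d.
  apply: (le_lt_trans ue); rewrite ltr_pdivrMr// ltr_pMr ?ltr1n//.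
  by rewrite normc_gt0 gt_eqF.
by move=> /(_ isT); lra.
Qed.

Section Eigenvector.
Context (n : nat) (zeta : R[i]).
Context (zetaX : zeta ^+ n.+1 = 1).
Context (zeta_neq1 : zeta != 1).

Definition wave (p : cycles) : R[i] :=
  (tag p == n)%:R * zeta ^+ (tagged p).

Lemma waveE j (x : 'I_j.+1) : wave (st x) = (j == n)%:R * zeta ^+ x.
Proof. by []. Qed.

Definition wave_eigen : R[i] :=
  (speed n)%:C * (zeta^-1 - 1) - (rate n)%:C.

Let zeta0 : zeta != 0.
Proof.
by apply/eqP => z0; have /eqP := zetaX; rewrite z0 expr0n eq_sym oner_eq0.
Qed.

Lemma normc_zeta : normc zeta = 1.
Proof.
have := congr1 (@normc R) zetaX; rewrite normcX normc1 => /eqP.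
by rewrite pexpr_eq1 ?normc_ge0// => /eqP.
Qed.

Lemma block_norm_wave j : block_norm wave j = if j == n then n.+1%:R else 0.
Proof.
rewrite /block_norm; case: eqVneq => [->|jn].
  rewrite (eq_bigr (fun=> 1)) ?sumr_const ?card_ord// => x _.
  by rewrite /wave/= eqxx mul1r normcX normc_zeta expr1n.
by apply: big1 => x _; rewrite /wave/= (negbTE jn) mul0r normc0.
Qed.

Lemma sum_single (a : R) N : 0 <= a ->
  \sum_(j < N) (if val j == n then a else 0) <= a.
Proof.
move=> a0; have [nN|Nn] := ltnP n N.
  rewrite (bigD1 (Ordinal nN))//= eqxx big1 ?addr0// => j.
  by rewrite -val_eqE/= => /negbTE ->.
rewrite big1 => // j _; rewrite ifF//; apply/eqP => jn.
by have := ltn_ord j; rewrite [nat_of_ord j]jn ltnNge Nn.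
Qed.

Lemma summing_wave : summing wave.
Proof.
exists n.+1%:R => N; under eq_bigr do rewrite block_norm_wave.
exact: sum_single.
Qed.

(** A nontrivial character sums to 0. All averages of a wave therefore vanish, and on waves a
    multiplier reduces to convolution. *)
Lemma block_sum_wave j : block_sum wave j = 0.
Proof.
rewrite /block_sum; have [->|jn] := eqVneq j n; last first.
  by apply: big1 => x _; rewrite /wave/= (negbTE jn) mul0r.
have h : (zeta - 1) * \sum_(x < n.+1) zeta ^+ x = 0.
  by rewrite -subrX1 zetaX subrr.
under eq_bigr do rewrite /wave/= eqxx mul1r.
by move/eqP: h; rewrite mulf_eq0 subr_eq0 (negbTE zeta_neq1) => /eqP.
Qed.

Lemma mult_scale_wave k a : mult k (a *: wave) = a *: conv k wave.
Proof.
rewrite -convZr; apply/funext => p.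
rewrite /mult [coupling _ _](_ : _ = fun=> 0) ?tail0 ?addr0//.
apply/funext => j; rewrite /coupling psumZ /psum big1 ?mulr0 ?mul0r ?mulr0// => i _.
exact: block_sum_wave.
Qed.

Lemma conv_gen_wave : conv gen wave = wave_eigen *: wave.
Proof.
apply/funext => -[j x]; rewrite -/(st x) conv_gen.
transitivity (wave_eigen * wave (st x)) => //.
rewrite !waveE; have [jn|_] := eqVneq j n; last first.
  by rewrite !mul0r !mulr0 subrr.
subst j; rewrite !mul1r.
rewrite val_sub1 /wave_eigen.
have -> : zeta ^+ (if x == 0 then n else x.-1) = zeta^-1 * zeta ^+ x.
  apply: (mulfI zeta0); rewrite mulVKf// -exprS.
  case: eqVneq => [->|x0]; first by rewrite zetaX expr0.
  by rewrite prednK// lt0n; apply: contra_neq x0 => ?; exact: val_inj.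
by rewrite rmorphD/=; ring.
Qed.

Let w : E := mk (n.+1%:R^-1 *: wave).

Lemma ev_w : ev w = n.+1%:R^-1 *: wave.
Proof.
apply: mkK; have [B hB] := summing_wave; exists (normc n.+1%:R^-1 * B) => N.
under eq_bigr do rewrite block_normZ.
by rewrite -mulr_sumr ler_wpM2l ?normc_ge0.
Qed.

Lemma normc_natV : normc (n.+1%:R^-1 : R[i]) = n.+1%:R^-1.
Proof. by rewrite normcV -(rmorph_nat (real_complex R)) normcC ger0_norm. Qed.

Lemma l1norm_w : l1norm (ev w) = 1.
Proof.
apply/eqP; rewrite eq_le; apply/andP; split.
  apply: (proj2 (l1norm_le _)) => N; rewrite ev_w.
  under eq_bigr do rewrite block_normZ block_norm_wave normc_natV.
  rewrite -mulr_sumr; apply: (@le_trans _ _ (n.+1%:R^-1 * n.+1%:R)).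
    by rewrite ler_pM2l ?invr_gt0// sum_single.
  by rewrite mulVf.
have := block_norm_le n (ev_summing w).
by rewrite {1}ev_w block_normZ block_norm_wave eqxx normc_natV mulVf.
Qed.

(** Only the n-th block of a kernel acts on this wave, so entrywise convergence to [gen] suffices
    although the blocks of [gen] are unbounded in n. *)
Lemma generator_wave : generator_dom T w /\ generator T w = wave_eigen *: w.
Proof.
apply: generatorE; apply: cvg_l1norm => e e0.
pose K (h : R) := h^-1%:C *: (kap h - unit0).
have hb : block_norm (K h - gen) n @[h --> 0^'+] --> 0.
  by apply: block_norm_cvg0 => p; exact: kap_diff.
have /cvgrPdist_le/(_ _ e0) hbe := hb.
near=> h.
have h0 : 0 < h by [].
have hC := controlled_kap speed0 (ltW h0).
have hK : controlled _ (K h) := controlledZ h^-1%:C (controlledB hC controlled_unit0).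
have -> : diff_quotient T w h = op (K h) w.
  rewrite (opZ_ker _ _ (controlledB hC controlled_unit0)).
  by rewrite (opB_ker _ hC controlled_unit0) op_unit0.
have -> : ev (op (K h) w - wave_eigen *: w) = n.+1%:R^-1 *: conv (K h - gen) wave.
  rewrite convBl conv_gen_wave.
  apply/funext => p; rewrite evB evZ (ev_op _ hK) ev_w mult_scale_wave.
  transitivity (n.+1%:R^-1 * (conv (K h) wave p - wave_eigen * wave p)) => //.
  rewrite mulrBr; congr (_ - _).
  transitivity (wave_eigen * (n.+1%:R^-1 * wave p)) => //.
  by rewrite mulrCA.
have : block_norm (K h - gen) n <= e.
  by apply: le_trans (ler_norm _) _; rewrite -normrN -sub0r; near: h.
apply: le_trans; apply: (proj2 (l1norm_le _)) => N.
apply: (@le_trans _ _ (\sum_(j < N) (if val j == n then block_norm (K h - gen) n else 0))).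
  apply: ler_sum => j _; rewrite block_normZ normc_natV ler_pdivrMl//.
  apply: (le_trans (block_norm_conv _ _ _)); rewrite block_norm_wave.
  by case: eqVneq => [->|_]; rewrite ?mulr0// mulrC.
by apply: sum_single; exact: block_norm_ge0.
Unshelve. all: by end_near. Qed.

End Eigenvector.
End Spectrum.

(** * The spectrum on the imaginary axis *)

Section BoundarySpectrum.
Context {R : realType}.
Local Notation E := (cL1 (cmu R)).
Local Notation T := (@rotor R).

(** An inverse would give f whose image under the generator is [- d0], of total mass -1, although
    difference quotients of f have total mass 0. Mass is measured by [psum], and two errors of 1/4
    cannot add up to 1. *)
Lemma spectrum0 : spectrum (generator_dom T) (generator T) 0.
Proof.
move=> [S [_ _ SD _]].
pose d0 : cycles -> R[i] := fun p => (p == st (ord0 : 'I_1))%:R.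
have bd n : block_norm d0 n = (n == 0)%:R.
  rewrite /block_norm; case: n => [|n].
    by rewrite big_ord_recl big_ord0 addr0 /d0 eqxx normc1.
  by rewrite big1// => x _; rewrite /d0 normc0.
have sd : summing d0.
  exists 1 => -[|N]; first by rewrite big_ord0.
  rewrite (eq_bigr (fun n : 'I_N.+1 => ((n : nat) == 0)%:R)) => [|n _]; last exact: bd.
  by rewrite big_ord_recl big1 ?addr0.
have [df] := SD (mk d0); rewrite scale0r sub0r => /(congr1 (@GRing.opp _)).
rewrite opprK => Af; set f := S (mk d0) in df Af.
have quarter : 0 < 4^-1 :> R by [].
have hq : \forall h \near (0 : R)^'+,
    l1norm (ev (diff_quotient T f h - generator T f)) <= 4^-1.
  exact: l1norm_cvg (generator_domP df) _ quarter.
have : \forall h \near (0 : R)^'+, False.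
  near=> h.
  have h0 : 0 < h by [].
  have hh : l1norm (ev (diff_quotient T f h - generator T f)) <= 4^-1 by near: h.
  have sf := ev_summing f.
  have md n := mass_defect n (ltW h0) sf.
  have c0 : h^-1 * ((1 + 2 * h) * l1norm (ev f) * rate n) @[n --> \oo] --> 0.
    rewrite [X in _ --> X](_ : _ = h^-1 * ((1 + 2 * h) * l1norm (ev f) * 0)); last first.
      by rewrite !mulr0.
    apply: cvgM; first exact: cvg_cst.
    by apply: cvgM; [exact: cvg_cst|exact: cvg_rate].
  (* N is chosen after h, so large that the mass defect at N divided by h is at most 1/4. *)
  have /cvgrPdist_le/(_ _ quarter) [N _ /(_ N (leqnn N)) hN] := c0.
  have := psum_le N (ev_summing (diff_quotient T f h - generator T f)).
  move=> /le_trans/(_ hh).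
  have -> : ev (diff_quotient T f h - generator T f) =
      h^-1%:C *: (mult (kap (@speed R) h) (ev f) - ev f) + d0.
    by apply/funext => p; rewrite evB evZ evB ev_rotor ?ltW// Af evN mkK// opprK.
  rewrite psumD psumZ.
  have -> : psum d0 N = 1.
    rewrite /psum big_ord_recl big1 ?addr0; last first.
      by move=> i _; rewrite /block_sum big1// => x _; rewrite /d0.
    by rewrite /block_sum big_ord_recl big_ord0 addr0 /d0 eqxx.
  have -> : psum (mult (kap (@speed R) h) (ev f) - ev f) N =
      psum (mult (kap (@speed R) h) (ev f)) N - psum (ev f) N.
    by rewrite -scaleN1r psumD psumZ mulN1r.
  set z := _ - _ => hz.
  have zn : normc (h^-1%:C * z) <= 4^-1.
    rewrite normcM normcC gtr0_norm ?invr_gt0//; apply: le_trans hN.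
    rewrite sub0r normrN; apply: le_trans (ler_norm _).
    by rewrite ler_pM2l ?invr_gt0//; exact: md.
  have : normc (1 : R[i]) <= 4^-1 + 4^-1.
    have -> : (1 : R[i]) = (h^-1%:C * z + 1) - h^-1%:C * z by ring.
    apply: (le_trans (ler_normcD _ _)); rewrite normcN; exact: lerD.
  rewrite normc1; lra.
by move=> /filter_ex [].
Unshelve. all: by end_near. Qed.

(** The choice of y makes r y = k th exactly. Taylor bounds then leave an error 2 k y in each
    coordinate, besides [rate m], and y <= 8 k / (m+1) because pi < 4: hence 32 k^2. The sign [sg]
    serves both halves of the axis. *)
Lemma eigen_dist (k m : nat) (th s y r : R) (sg : bool) :
  y = 2 * pi * k%:R / m.+1%:R -> r = m.+1%:R * th / (pi *+ 2) ->
  (0 < k)%N -> 0 <= th <= 2 -> y <= 1 ->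
  normc (0 +i* ((-1) ^+ sg * s) -
         (r%:C * ((cis ((-1) ^+ sg * y)) - 1) - (rate m)%:C)) <=
  (32 * k%:R ^+ 2 + 1) / m.+1%:R + `|k%:R * th - s|.
Proof.
move=> yE rE k0 /andP[th0 th2] y1.
have p0 : 0 < pi :> R by exact: pi_gt0.
have p4 : pi < 4 :> R by have := @pihalf_lt2 R; rewrite ltr_pdivrMr//; lra.
have k0' : 1 <= k%:R :> R by rewrite ler1n.
have m0 : 0 < m.+1%:R :> R by [].
have y0 : 0 < y by rewrite yE divr_gt0// !mulr_gt0//; lra.
have ry : r * y = k%:R * th.
  rewrite rE yE -mulr_natr; move: (pi : R) (m.+1%:R : R) p0 m0 => P N P0 N0.
  by field; rewrite !gt_eqF.
have r0 : 0 <= r.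
  by rewrite rE; apply: divr_ge0; [exact: mulr_ge0|rewrite mulrn_wge0 ?pi_ge0].
have yk : y <= 8 * k%:R / m.+1%:R.
  rewrite yE ler_pM2r ?invr_gt0// ler_wpM2r//; lra.
have h1 : 0 <= r * (1 - cos y) <= 2 * k%:R * y.
  apply/andP; split; first by rewrite mulr_ge0// subr_ge0 cos_le1.
  apply: (@le_trans _ _ (r * y ^+ 2)); first by rewrite ler_wpM2l// cos_ge_sqr ?ltW.
  by rewrite expr2 mulrA ry ler_pM2r//; nra.
have h2 : 0 <= k%:R * th - r * sin y <= 2 * k%:R * y.
  rewrite -ry; apply/andP; split.
    by rewrite -mulrBr mulr_ge0// subr_ge0 sin_le_id ?ltW.
  rewrite -mulrBr; apply: (@le_trans _ _ (r * y ^+ 3)).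
    by rewrite ler_wpM2l//; have := sin_ge_lin (ltW y0); lra.
  apply: (@le_trans _ _ (r * y * y)).
    by rewrite -mulrA ler_wpM2l// exprS expr2 ler_piMl// mulr_ge0 ?(ltW y0).
  by rewrite ry ler_pM2r//; nra.
apply: (le_trans (normc_le_Re_Im _)).
have cE : cos ((-1) ^+ sg * y) = cos y.
  by case: sg; rewrite ?expr1 ?expr0 ?mulN1r ?mul1r ?cosN.
have sE : sin ((-1) ^+ sg * y) = (-1) ^+ sg * sin y.
  by case: sg {cE}; rewrite ?expr1 ?expr0 ?mulN1r ?mul1r ?sinN.
rewrite /cis/= cE sE.
have -> : 0 - (r * (cos y - 1) - 0 * ((-1) ^+ sg * sin y - 0) - rate m) =
   r * (1 - cos y) + rate m by ring.
have -> : (-1) ^+ sg * s - (r * ((-1) ^+ sg * sin y - 0) + 0 * (cos y - 1) - 0) =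
   (-1) ^+ sg * (s - r * sin y) by ring.
rewrite normrM normrX normrN1 expr1n mul1r.
have hr : rate m = 1 / m.+1%:R :> R by rewrite div1r.
have rm := @rate_gt0 R m.
have h3 : `|s - r * sin y| <= `|k%:R * th - s| + 2 * k%:R * y.
  have -> : s - r * sin y = - (k%:R * th - s) + (k%:R * th - r * sin y) by ring.
  apply: (le_trans (ler_normD _ _)); rewrite normrN lerD2l.
  by have /andP[a b] := h2; rewrite ger0_norm.
have h4 : 4 * k%:R * y <= 32 * k%:R ^+ 2 / m.+1%:R.
  apply: (@le_trans _ _ (4 * k%:R * (8 * k%:R / m.+1%:R))).
    by rewrite ler_wpM2l// mulr_ge0.
  by have -> : 4 * k%:R * (8 * k%:R / m.+1%:R) = 32 * k%:R ^+ 2 / m.+1%:R :> R by ring.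
have /andP[h1a h1b] := h1.
have h5 : 0 <= r * (1 - cos y) + rate m by rewrite addr_ge0// ltW.
rewrite (ger0_norm h5) [(_ + 1) / _]mulrDl -hr.
have h6 : 4 * k%:R * y = 2 * k%:R * y + 2 * k%:R * y by ring.
rewrite h6 in h4.
move: (r * (1 - cos y)) (rate m) `|s - r * sin y| `|k%:R * th - s|
  (2 * k%:R * y) (32 * k%:R ^+ 2 / m.+1%:R) h1b h3 h4 => A B C D F G; lra.
Qed.

Lemma spectrum_ge1 (s : R) (sg : bool) : 1 <= s ->
  spectrum (generator_dom T) (generator T) (0 +i* ((-1) ^+ sg * s)).
Proof.
move=> s1; apply: approx_eigenvalue => e e0.
pose k := Num.truncn s.
have s0 : 0 <= s by lra.
have /andP[k1 k2] := truncn_itv s0; rewrite -/k in k1 k2.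
have k0 : (0 < k)%N by rewrite truncn_gt0.
have k0' : 1 <= k%:R :> R by rewrite ler1n.
have kp : 0 < k%:R :> R by lra.
have tau12 : 1 <= s / k%:R < 2.
  rewrite ler_pdivlMr// mul1r k1/= ltr_pdivrMr//; apply: (lt_le_trans k2).
  by rewrite -natr1; lra.
(* The first summand makes (32 k^2 + 1) / (m+1) at most e / 2, the second makes y at most 1. The
   error on theta gets multiplied by k, hence the tolerance e / (2 k). *)
pose M := Num.truncn (2 * (32 * k%:R ^+ 2 + 1) / e + 8 * k%:R).
have e2 : 0 < e / (2 * k%:R) by rewrite divr_gt0// mulr_gt0.
have [m Mm hm] := theta_dense M tau12 e2.
have c0 : 0 < 32 * k%:R ^+ 2 + 1 :> R by rewrite ltr_wpDl// mulr_ge0// exprn_ge0// ltW.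
have mM : 2 * (32 * k%:R ^+ 2 + 1) / e + 8 * k%:R < m.+1%:R.
  by apply: (lt_le_trans (truncnS_gt _)); rewrite ler_nat ltnS.
have c1 : 0 < 2 * (32 * k%:R ^+ 2 + 1) / e by rewrite divr_gt0// mulr_gt0.
have m8 : 8 * k%:R < m.+1%:R :> R by lra.
have m2 : 2 * (32 * k%:R ^+ 2 + 1) / e < m.+1%:R by lra.
have m0 : 0 < m.+1%:R :> R by [].
pose y : R := 2 * pi * k%:R / m.+1%:R.
have p0 : 0 < pi :> R by exact: pi_gt0.
have p2 := @pi_ge2 R.
have p4 : pi < 4 :> R by have := @pihalf_lt2 R; rewrite ltr_pdivrMr//; lra.
have y1 : y <= 1.
  rewrite /y ler_pdivrMr// mul1r; apply: le_trans (ltW m8).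
  by rewrite ler_pM2r//; lra.
have y0 : 0 < y by rewrite /y divr_gt0// !mulr_gt0.
(* The eigenvalue of a wave involves the inverse of [zeta], hence the minus sign. *)
pose zeta : R[i] := cis (- ((-1) ^+ sg * y)).
have zetaX : zeta ^+ m.+1 = 1.
  rewrite /zeta -cisMn mulrN.
  have -> : m.+1%:R * ((-1) ^+ sg * y) = k%:R * ((-1) ^+ sg * (pi *+ 2)).
    rewrite /y -mulr_natr; move: (pi : R) (m.+1%:R : R) ((-1) ^+ sg) m0 => P N g N0.
    by field; rewrite gt_eqF.
  rewrite -mulrN cisMn -mulrN.
  have -> : cis ((-1) ^+ sg * - (pi *+ 2)) = 1 :> R[i].
    rewrite /cis; case: sg {zeta}; rewrite ?expr0 ?expr1 ?mulN1r ?mul1r ?opprK;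
      by rewrite ?cosN ?sinN cos2pi sin2pi ?oppr0.
  by rewrite expr1n.
have zeta1 : zeta != 1.
  apply/eqP => z1.
  have := congr1 (@complex.Re R) z1; rewrite /zeta/= cosN.
  have -> : cos ((-1) ^+ sg * y) = cos y.
    by case: sg {zeta zetaX z1}; rewrite ?expr1 ?expr0 ?mulN1r ?mul1r ?cosN.
  have : cos y < 1 by apply: cos_lt1; rewrite y0/=; lra.
  by move=> /[swap] ->; rewrite ltxx.
have zetaV : zeta^-1 = cis ((-1) ^+ sg * y).
  have z0 : zeta != 0 by rewrite -normc_eq0 normc_cis oner_eq0.
  by apply: (mulfI z0); rewrite mulfV// /zeta -cisD addNr cis0.
have [dw gw] := generator_wave zetaX zeta1.
exists (mk (m.+1%:R^-1 *: wave m zeta)); split=> //; first exact: l1norm_w.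
rewrite gw -scalerBl.
set mu := _ - _; rewrite -[X in ev X]/(mu *: mk (m.+1%:R^-1 *: wave m zeta)).
have -> : l1norm (ev (mu *: mk (m.+1%:R^-1 *: wave m zeta))) = normc mu.
  have : `|mu *: mk (m.+1%:R^-1 *: wave m zeta)| = `|mu| * `|mk (m.+1%:R^-1 *: wave m zeta)|.
    exact: normrZ.
  by rewrite !norm_ev l1norm_w// mulr1 -Defs.normcE => -[].
rewrite /mu /wave_eigen zetaV.
have th : 0 <= (theta m : R) <= 2.
  by have /andP[t1 t2] := @theta_bounds R m; apply/andP; split; lra.
apply: (le_trans (@eigen_dist k m (theta m) s y (speed m) sg (erefl _) (erefl _) k0 th y1)).
have h1 : (32 * k%:R ^+ 2 + 1) / m.+1%:R <= e / 2.
  rewrite ler_pdivrMr// mulrAC ler_pdivlMr// [e * _]mulrC -ler_pdivrMr//.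
  by rewrite [X in X / _]mulrC ltW.
have h2 : `|k%:R * theta m - s| <= e / 2.
  have -> : k%:R * theta m - s = k%:R * (theta m - s / k%:R).
    by field; rewrite gt_eqF.
  rewrite normrM gtr0_norm//.
  apply: (@le_trans _ _ (k%:R * (e / (2 * k%:R)))).
    by rewrite ler_pM2l// ltW.
  suff -> : k%:R * (e / (2 * k%:R)) = e / 2 by [].
  by field; rewrite gt_eqF.
by rewrite [e]splitr lerD.
Qed.

Lemma spectrum_lt1 (s : R) : s != 0 -> `|s| < 1 ->
  ~ spectrum (generator_dom T) (generator T) (0 +i* s).
Proof.
move=> s0 s1; apply; have [C rC] := controlled_rho s0 s1.
exact: resolvent_op rC (conv_gen_rho_im s0 s1).
Qed.

End BoundarySpectrum.

Theorem theorem3p2 (R : realType) :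
  exists (d : measure_display) (X : measurableType d)
    (mu : {sigma_finite_measure set X -> \bar R})
    (T : R -> cL1 mu -> cL1 mu),
    [/\ C0_semigroup T,
        irreducible_semigroup T,
        stochastic_semigroup T &
        spectrum (generator_dom T) (generator T) `&` @imaginary_axis R =
          [set (0 +i* s) | s in `]-oo, (-1)]] `|` [set 0] `|`
          [set (0 +i* s) | s in `[1, +oo[] ].
Proof.
exists default_measure_display, cycles, (cmu R), (@rotor R); split.
- exact: rotor_C0.
- exact: rotor_irreducible.
- exact: rotor_stochastic.
apply/seteqP; split=> [[a s] [/= spec]|].
  rewrite /imaginary_axis/= => a0; rewrite a0 in spec *.
  have [s0|s0] := eqVneq s 0; first by left; right; rewrite s0.
  have [s1|s1] := ltP `|s| 1; first by have := spectrum_lt1 s0 s1.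
  have [sp|sn] := leP 0 s.
    by right; exists s => //; rewrite /= in_itv/= andbT -(ger0_norm sp).
  left; left; exists s => //; rewrite /= in_itv/= -lerNr.
  by rewrite -(ltr0_norm sn).
move=> z [[[s]|->]|[s]].
- rewrite /= in_itv/= => s1 <-; split=> //.
  have := @spectrum_ge1 R (- s) true; rewrite expr1 mulN1r opprK; apply.
  by rewrite lerNr.
- by split=> //; exact: spectrum0.
- rewrite /= in_itv/= andbT => s1 <-; split=> //.
  by have := @spectrum_ge1 R s false; rewrite expr0 mul1r; exact.
Qed.
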